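(* Let $A$ be a differential graded commutative $R$-algebra and $L$ a differential graded $A$-module having the property that the canonical $A$-module morphism from $L$ to its double $A$-dual $\mathrm{Hom}_A(\mathrm{Hom}_A(L,A),A)$ is injective. Let $\partial$ be a filtered degree $-1$ filtration lowering coderivation on $\mathrm S[sL]$ and $t\colon\mathrm S[sL]\to\mathrm{Der}(A|R)$ a filtered degree $-1$ morphism, and let $\mathcal D_0$ denote the algebra differential on $\mathrm{Sym}_A(sL,A)$ induced from the differentials on $L$ and $A$. For $j\ge1$ let $\mathcal D_j=\partial^{t_j}+\partial^{*}_j$ be the associated derivation of $\mathrm{Hom}(\mathrm S[sL],A)$. Then $(A,L,\partial,t)$ is an sh Lie-Rinehart algebra if and only if $$(\mathrm{Sym}_A(sL,A),\mathcal D_0,\mathcal D_1,\mathcal D_2,\ldots)$$ is a multi derivation chain algebra (that is, each $\mathcal D_j$, $j\ge1$, passes to a derivation of $\mathrm{Sym}_A(sL,A)$ and the resulting data constitute a multi derivation chain algebra), necessarily the multi derivation Maurer-Cartan algebra associated to $(A,L,\partial,t)$.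
   Context: Conventions. $R$ is a commutative ring containing $\mathbb Q$ as a subring; unadorned $\otimes$ and $\mathrm{Hom}$ are over $R$. Graded means $\mathbb Z$-graded (only homogeneous elements are considered); differentials have degree $-1$; the Eilenberg-Koszul sign convention is in force. The Hom-differential is $\mathcal D(f)=d\circ f+(-1)^{|f|+1}f\circ d$. $sL$ denotes the suspension of $L$ (regraded up by one). $\mathrm{Der}(A|R)$ is the differential graded $R$-Lie algebra of graded $R$-linear derivations of $A$. Coalgebra. $\mathrm S[sL]=\bigoplus_k\mathrm S^k[sL]$ is the graded symmetric $R$-algebra on $sL$, viewed as a coaugmented differential graded cocommutative $R$-coalgebra via the shuffle diagonal $\Delta$ (elements of $sL$ primitive); since $R\supseteq\mathbb Q$, it is canonically the cofree graded cocommutative coalgebra on $sL$. Its differential $d^0$ is induced from that of $L$, and its coaugmentation filtration is $C_j=\bigoplus_{k\le j}\mathrm S^k[sL]$. A filtered degree $-1$ filtration lowering coderivation on $\mathrm S[sL]$ is a degree $-1$ coderivation $\partial=\partial^1+\partial^2+\cdots$ that lowers the coaugmentation filtration, where here $\partial^j$ is the coderivation determined by the constituent $\partial\colon\mathrm S^{j+1}[sL]\to sL$ (it lowers filtration by $j$). A filtered degree $-1$ morphism $t=t_1+t_2+\cdots\colon\mathrm S[sL]\to\mathrm{Der}(A|R)$ is a degree $-1$ $R$-module morphism vanishing on $\mathrm S^0[sL]=R$, where here $t_j$ is its component on $\mathrm S^j[sL]$. An sh Lie algebra structure on a chain complex $L$ over $R$ is a coderivation $\partial$ as just described with $(d^0+\partial)^2=0$.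 An sh-action of $(L,\partial)$ on $A$ by derivations is a Lie algebra twisting cochain $t\colon(\mathrm S[sL],d^0+\partial)\to\mathrm{Der}(A|R)$, i.e. a degree $-1$ morphism vanishing on the image of the coaugmentation with $\mathcal Dt+t\wedge t=0$, where $\mathcal Dt$ is the Hom-differential formed with $d^0+\partial$, $t\wedge t=\tfrac12[t,t]$ and $[f,g]=[\cdot,\cdot]\circ(f\otimes g)\circ\Delta$. sh Lie-Rinehart algebra. Data $(A,L,\partial,t)$ with $A$ a differential graded commutative $R$-algebra, $(L,\partial)$ an sh Lie algebra over $R$ carrying also a differential graded $A$-module structure (so $sL$ is a differential graded $A$-module), and $t$ an sh-action of $(L,\partial)$ on $A$ by derivations, such that $t$ is graded $A$-multilinear (each $t_j$ is graded $A$-multilinear, e.g. $t_j(a\alpha_1,\ldots,\alpha_j)=(-1)^{|a|}a\,t_j(\alpha_1,\ldots,\alpha_j)$) and, for all $j\ge1$ and homogeneous $\alpha_1,\ldots,\alpha_{j+1}\in sL$, $a\in A$, $$\partial^j(\alpha_1,\ldots,\alpha_j,a\alpha_{j+1})=t_j(\alpha_1,\ldots,\alpha_j)(a)\,\alpha_{j+1}+(-1)^{(|\alpha_1|+\cdots+|\alpha_j|+1)|a|}a\,\partial^j(\alpha_1,\ldots,\alpha_j,\alpha_{j+1}),$$ where $\partial^j$ denotes the constituent $\mathrm S^{j+1}[sL]\to sL$. Derivations. $\mathrm{Hom}(\mathrm S[sL],A)$ is a differential graded commutative algebra under the cup product and the Hom-differential $\mathcal D_0$ (formed with $d^0$ and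 the differential of $A$). For $j\ge1$, $\partial^{*}_j(\varphi)=(-1)^{|\varphi|+1}\varphi\circ\partial^j$, and $\partial^{t_j}(\varphi)=[t_j,\varphi]$ is the composite of $\Delta$, $t_j\otimes\varphi$, and the evaluation $\mathrm{Der}(A|R)\otimes A\to A$. $\mathrm{Sym}_A(sL,A)=\mathrm{Hom}_A(\mathrm S_A[sL],A)$, with $\mathrm S_A[sL]$ the graded symmetric $A$-algebra on $sL$, is the subalgebra of $\mathrm{Hom}(\mathrm S[sL],A)$ of those forms that are graded $A$-multilinear on each $\mathrm S^k[sL]$, $k\ge1$ (the degree $k=0$ part being $A$); it is preserved by $\mathcal D_0$. A derivation of $\mathrm{Hom}(\mathrm S[sL],A)$ passes to $\mathrm{Sym}_A(sL,A)$ if it maps this subalgebra to itself. $\mathrm{Sym}_A(sL,A)$ is filtered by $\mathrm{Sym}_A(sL,A)^{j}=\{\text{forms vanishing on }C_{j-1}\}$, $j\ge0$ ($C_{-1}=0$). A multi derivation chain algebra is a differential graded commutative algebra $(\mathcal A,\mathcal D_0)$ with a descending filtration $\mathcal A=\mathcal A^0\supseteq\mathcal A^1\supseteq\cdots$ compatible with $\mathcal D_0$ and with degree $-1$ $R$-linear derivations $\mathcal D_j$ ($j\ge1$) such that each $\mathcal D_j$, when non-zero, lowers the filtration by $j$ ($\mathcal D_j(\mathcal A^\ell)\subseteq\mathcal A^{\ell+j}$ for all $\ell\geq 0$) but not by $j+1$, such that $\sum_{j\ge 1}\mathcal D_j$ converges (naively, or with respect to the filtration when it is complete), and such that $\sum_{j\ge0}\mathcal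 D_j$ is a differential. The multi derivation Maurer-Cartan algebra associated to an sh Lie-Rinehart algebra $(A,L,\partial,t)$ is the multi derivation chain algebra $(\mathrm{Sym}_A(sL,A),\mathcal D_0,\mathcal D_1,\ldots)$ with $\mathcal D_j=\partial^{t_j}+\partial^*_j$ for $j\ge1$. *)

(* Defs.v *)
From HB Require Import structures.
From mathcomp Require Import all_boot all_order all_algebra.
From mathcomp Require Import zify.
From mathcomp Require Import boolp classical_sets functions cardinality fsbigop.
From mathcomp.multinomials Require Import freeg.

Set Implicit Arguments.
Unset Strict Implicit.
Unset Printing Implicit Defensive.

Import GRing.Theory.
Local Open Scope ring_scope.
Local Open Scope quotient_scope.

Section FreeLift.
Variables (R : nzRingType) (X : choiceType) (N : lmodType R) (f : X -> N).

Lemma fglift_is_linear : linear (@fglift R N X f).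
Proof.
have addf := lift_is_additive f.
have add0 : fglift f 0 = 0 by have := addf 0 0; rewrite !subrr.
have addN u : fglift f (- u) = - fglift f u.
  by have := addf 0 u; rewrite add0 !sub0r.
have addD u v : fglift f (u + v) = fglift f u + fglift f v.
  by have := addf u (- v); rewrite opprK addN opprK.
have fsum (s : seq X) (F : X -> {freeg X / R}) :
    fglift f (\sum_(x <- s) F x) = \sum_(x <- s) fglift f (F x).
  by elim: s => [|x s ih]; rewrite ?big_nil ?add0 // !big_cons addD ih.
move=> c u v; rewrite addD; congr (_ + _).
rewrite -[in RHS](freeg_sumE u) fsum scaler_sumr [c *: u]/(fgscale c u).
by rewrite fsum; apply: eq_bigr => x _; rewrite !liftU scalerA.
Qed.

End FreeLift.

Section Presented.
Variables (R : nzRingType) (X : choiceType) (rel : {freeg X / R} -> Prop).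
Local Notation F := {freeg X / R}.

Definition pres_span (D : F) : Prop :=
  exists s : seq (R * F),
    (forall c, c \in s -> rel c.2) /\ D = \sum_(c <- s) c.1 *: c.2.

Lemma pres_span0 : pres_span 0.
Proof. by exists [::]; rewrite big_nil. Qed.

Lemma pres_spanD D1 D2 : pres_span D1 -> pres_span D2 -> pres_span (D1 + D2).
Proof.
move=> [s1 [h1 ->]] [s2 [h2 ->]]; exists (s1 ++ s2); rewrite big_cat; split=> //.
by move=> c; rewrite mem_cat => /orP[/h1|/h2].
Qed.

Lemma pres_spanZ a D : pres_span D -> pres_span (a *: D).
Proof.
move=> [s [h ->]]; exists [seq (a * c.1, c.2) | c <- s]; split.
  by move=> d /mapP[c cs ->]; exact: (h c cs).
by rewrite big_map scaler_sumr; apply: eq_bigr => c _; rewrite scalerA.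
Qed.

Lemma pres_spanN D : pres_span D -> pres_span (- D).
Proof. by move=> h; rewrite -scaleN1r; exact: pres_spanZ. Qed.

Lemma pres_span_rel D : rel D -> pres_span D.
Proof.
move=> h; exists [:: (1, D)]; split; last by rewrite big_seq1 scale1r.
by move=> c; rewrite inE => /eqP ->.
Qed.

Definition pres_eqv (D1 D2 : F) : bool := `[< pres_span (D1 - D2) >].

Lemma pres_eqv_refl : reflexive pres_eqv.
Proof. by move=> D; apply/asboolP; rewrite subrr; exact: pres_span0. Qed.

Lemma pres_eqv_sym : symmetric pres_eqv.
Proof.
by move=> D1 D2; apply/asboolP/asboolP => /pres_spanN; rewrite opprB.
Qed.

Lemma pres_eqv_trans : transitive pres_eqv.
Proof.
move=> D2 D1 D3 /asboolP h1 /asboolP h2; apply/asboolP.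
by have := pres_spanD h1 h2; rewrite addrA subrK.
Qed.

Canonical pres_equiv :=
  EquivRel pres_eqv pres_eqv_refl pres_eqv_sym pres_eqv_trans.

Definition presented : Type := {eq_quot pres_equiv}.
HB.instance Definition _ := Choice.on presented.
HB.instance Definition _ := Quotient.on presented.
HB.instance Definition _ : EqQuotient F pres_eqv presented :=
  EqQuotient.on presented.

Definition pclass (D : F) : presented := \pi_presented D.

Lemma pclassP D1 D2 : pclass D1 = pclass D2 <-> pres_span (D1 - D2).
Proof.
by split=> [/eqmodP /asboolP|h]; last by apply/eqmodP/asboolP.
Qed.

Lemma pclass_repr (q : presented) : pclass (repr q) = q.
Proof. exact: reprK. Qed.

Lemma repr_pclass D : pres_span (repr (pclass D) - D).
Proof. by apply/pclassP; rewrite pclass_repr. Qed.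

Definition pres_add (q r : presented) := pclass (repr q + repr r).
Definition pres_opp (q : presented) := pclass (- repr q).
Definition pres_scale (c : R) (q : presented) := pclass (c *: repr q).

Lemma pres_addE D1 D2 : pres_add (pclass D1) (pclass D2) = pclass (D1 + D2).
Proof.
apply/pclassP; rewrite opprD addrACA.
exact: pres_spanD (repr_pclass _) (repr_pclass _).
Qed.

Lemma pres_oppE D : pres_opp (pclass D) = pclass (- D).
Proof. by apply/pclassP; rewrite -opprD; exact/pres_spanN/repr_pclass. Qed.

Lemma pres_scaleE c D : pres_scale c (pclass D) = pclass (c *: D).
Proof. by apply/pclassP; rewrite -scalerBr; exact/pres_spanZ/repr_pclass. Qed.

Fact pres_addA : associative pres_add.
Proof.
by move=> q r s; rewrite -[q]pclass_repr -[r]pclass_repr -[s]pclass_repr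
  !pres_addE addrA.
Qed.

Fact pres_addC : commutative pres_add.
Proof. by move=> q r; rewrite /pres_add addrC. Qed.

Fact pres_add0 : left_id (pclass 0) pres_add.
Proof. by move=> q; rewrite -[q]pclass_repr pres_addE add0r. Qed.

Fact pres_addN : left_inverse (pclass 0) pres_opp pres_add.
Proof. by move=> q; rewrite -[q]pclass_repr pres_oppE pres_addE addNr. Qed.

HB.instance Definition _ :=
  GRing.isZmodule.Build presented pres_addA pres_addC pres_add0 pres_addN.

Fact pres_scaleA a b (q : presented) :
  pres_scale a (pres_scale b q) = pres_scale (a * b) q.
Proof. by rewrite -[q]pclass_repr !pres_scaleE scalerA. Qed.

Fact pres_scale1 : left_id 1 pres_scale.
Proof. by move=> q; rewrite /pres_scale scale1r pclass_repr. Qed.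

Fact pres_scaleDr : right_distributive pres_scale +%R.
Proof.
move=> c q r; rewrite -[q]pclass_repr -[r]pclass_repr.
by rewrite [_ + _]pres_addE !pres_scaleE [RHS]pres_addE scalerDr.
Qed.

Fact pres_scaleDl (q : presented) : {morph pres_scale^~ q : a b / a + b}.
Proof.
move=> a b; rewrite -[q]pclass_repr.
by rewrite !pres_scaleE [RHS]pres_addE scalerDl.
Qed.

HB.instance Definition _ := GRing.Zmodule_isLmodule.Build R presented
  pres_scaleA pres_scale1 pres_scaleDr pres_scaleDl.

Lemma pclass_is_linear : linear pclass.
Proof. by move=> c D1 D2; rewrite -pres_addE -pres_scaleE. Qed.

HB.instance Definition _ :=
  GRing.isLinear.Build R F presented *:%R pclass pclass_is_linear.

Definition pgen (x : X) : presented := pclass << x >>.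

Section Lift.
Variables (N : lmodType R) (f : X -> N).

(* The linear map sending [pgen x] to [f x].  The definition is total, but it
   is meaningful only when [f] is compatible with the relations. *)
Definition plift (q : presented) : N := fglift f (repr q).

Definition pcompat : Prop := forall D, rel D -> fglift f D = 0.

Hypothesis compat : pcompat.

Lemma fglift_span D : pres_span D -> fglift f D = 0.
Proof.
have lin := fglift_is_linear f.
have f0 : fglift f 0 = 0 by have := lin (-1) 0 0; rewrite scaler0 addr0 scaleN1r addNr.
move=> [s [h ->]]; elim: s h => [|c s ih] h; first by rewrite big_nil.
rewrite big_cons lin compat ?scaler0 ?add0r; last first.
  by apply: h; rewrite mem_head.
by apply: ih => d ds; apply: h; rewrite inE ds orbT.
Qed.

Lemma plift_pclass D : plift (pclass D) = fglift f D.
Proof.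
have /fglift_span := repr_pclass D.
rewrite addrC -scaleN1r fglift_is_linear scaleN1r addrC => /eqP.
by rewrite subr_eq0 => /eqP.
Qed.

Lemma plift_gen x : plift (pgen x) = f x.
Proof. by rewrite plift_pclass liftU scale1r. Qed.

Lemma plift_is_linear : linear plift.
Proof.
move=> c q r; rewrite -[q]pclass_repr -[r]pclass_repr -linearP !plift_pclass.
exact: fglift_is_linear.
Qed.

End Lift.

Lemma pres_ind (P : presented -> Prop) :
  P 0 -> (forall c x q, P q -> P (c *: pgen x + q)) -> forall q, P q.
Proof.
move=> P0 PS q; rewrite -[q]pclass_repr -[repr q]freeg_sumE.
elim: (dom (repr q)) => [|x s ih]; first by rewrite big_nil raddf0.
rewrite big_cons linearD /=.
have -> : << coeff x (repr q) *g x >> = coeff x (repr q) *: << x >> :> F.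
  by apply/eqP/freeg_eqP => y; rewrite coeffZ !coeffU mul1r.
by rewrite linearZ; exact: PS.
Qed.

End Presented.

Arguments pgen {R X rel} x.
Arguments plift {R X rel N} f q.

Definition ksign (R : pzRingType) (n : int) : R := (-1) ^+ `|n|%N.
Arguments ksign {R} n.

Section Signs.
Variable R : pzRingType.

Lemma ksignD m n : ksign (m + n) = ksign m * ksign n :> R.
Proof.
rewrite /ksign -[LHS]signr_odd -[X in X * _]signr_odd -[X in _ * X]signr_odd.
rewrite -signr_addb; congr (_ ^+ _).
by case: m n => [m|m] [n|n]; lia.
Qed.

Lemma ksignN n : ksign (- n) = ksign n :> R.
Proof. by rewrite /ksign abszN. Qed.

Lemma ksign1 : ksign 1 = -1 :> R.
Proof. by []. Qed.

Lemma ksignMK n : ksign n * ksign n = 1 :> R.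
Proof. by rewrite /ksign -exprD addnn -mul2n exprM sqrrN expr1n expr1n. Qed.

End Signs.

(* A direct sum decomposition of [V] indexed by the integers, given by the
   projections onto the summands. *)
Record grading (R : nzRingType) (V : lmodType R) := Grading {
  gproj : int -> {linear V -> V};
  gprojE : forall m n x, gproj m (gproj n x) = if m == n then gproj n x else 0;
  gproj_sum : forall x, exists2 s : seq int, uniq s & x = \sum_(n <- s) gproj n x
}.

Definition homog (R : nzRingType) (V : lmodType R) (G : grading V) (n : int)
  (x : V) : bool := gproj G n x == x.

(* [gsum G F x] is the sum of the [F n x_n], with [x_n] the components of [x];
   this is how maps depending on degrees extend to all elements. *)
Definition gsum (R : nzRingType) (V : lmodType R) (G : grading V)
    (W : lmodType R) (F : int -> V -> W) (x : V) : W :=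
  \sum_(n \in [set: int]) F n (gproj G n x).

Definition degree_map (R : nzRingType) (V W : lmodType R) (G : grading V)
    (H : grading W) (p : int) (f : V -> W) : Prop :=
  forall n x, homog G n x -> homog H (n + p) (f x).

Lemma lin_fun0 (R : nzRingType) (V W : lmodType R) (f : V -> W) :
  linear f -> f 0 = 0.
Proof. by move=> /(_ (-1) 0 0); rewrite scaler0 addr0 scaleN1r addNr. Qed.

Section GradedTheory.
Variables (R : nzRingType) (V : lmodType R) (G : grading V).

Lemma homog_gproj n x : homog G n (gproj G n x).
Proof. by rewrite /homog gprojE eqxx. Qed.

Lemma gproj_homog m n x : homog G n x -> gproj G m x = if m == n then x else 0.
Proof. by move=> /eqP <-; rewrite gprojE. Qed.

Lemma gproj_notin s x n :
  uniq s -> x = \sum_(k <- s) gproj G k x -> n \notin s -> gproj G n x = 0.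
Proof.
move=> us -> ns; rewrite raddf_sum big_seq big1 // => k ks.
by rewrite /= gprojE; case: eqP ns => // ->; rewrite ks.
Qed.

Variables (W : lmodType R) (F : int -> V -> W).
Hypothesis Flin : forall n, linear (F n).

Lemma gsum_fun0 n : F n 0 = 0.
Proof. exact: lin_fun0 (Flin n). Qed.

Lemma gsum_seq (s : seq int) x :
    uniq s -> (forall n, n \notin s -> gproj G n x = 0) ->
  gsum G F x = \sum_(n <- s) F n (gproj G n x).
Proof.
move=> us h; rewrite fsbig_seq //; apply/esym/fsbig_widen => // n [_ /=].
by move=> /negP /h ->; exact: gsum_fun0.
Qed.

Lemma gsum_is_linear : linear (gsum G F).
Proof.
move=> c x y; have [s us xs] := gproj_sum G x; have [t ut yt] := gproj_sum G y.
have ux := gproj_notin us xs; have uy := gproj_notin ut yt.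
have ust := undup_uniq (s ++ t).
have hx n : n \notin undup (s ++ t) -> gproj G n x = 0.
  by rewrite mem_undup mem_cat negb_or => /andP[/ux].
have hy n : n \notin undup (s ++ t) -> gproj G n y = 0.
  by rewrite mem_undup mem_cat negb_or => /andP[_ /uy].
rewrite !(gsum_seq ust) //; last first.
  by move=> n hn; rewrite linearP /= hx // hy // scaler0 addr0.
rewrite scaler_sumr -big_split; apply: eq_bigr => n _.
by rewrite linearP Flin.
Qed.

Lemma gsum_homog m x : homog G m x -> gsum G F x = F m x.
Proof.
move=> hx; rewrite (@gsum_seq [:: m]) ?big_seq1 ?(eqP hx) //.
by move=> n; rewrite inE (gproj_homog _ hx) => /negbTE ->.
Qed.

End GradedTheory.

Section Tensor.
Variables (R : comNzRingType) (M N : lmodType R).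

Inductive tens_rel : {freeg (M * N)%type / R} -> Prop :=
| TensLinl c x y z :
    tens_rel (<< (c *: x + y, z) >> - c *: << (x, z) >> - << (y, z) >>)
| TensLinr c x y z :
    tens_rel (<< (z, c *: x + y) >> - c *: << (z, x) >> - << (z, y) >>).

Definition tensor : lmodType R := presented tens_rel.
Definition tens (x : M) (y : N) : tensor := pgen (x, y).

Lemma tens_linl z : linear (tens^~ z).
Proof.
move=> c x y; have /pres_span_rel := TensLinl c x y z.
rewrite -addrA -opprD => /pclassP; rewrite /tens /pgen => ->.
by rewrite linearP.
Qed.

Lemma tens_linr z : linear (tens z).
Proof.
move=> c x y; have /pres_span_rel := TensLinr c x y z.
rewrite -addrA -opprD => /pclassP; rewrite /tens /pgen => ->.
by rewrite linearP.
Qed.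

(* The linear map induced by a family of bilinear maps [B m n], the [(m, n)]-th
   being used on the tensors [x (x) y] with [|x| = m] and [|y| = n]. *)
Definition htlift (G : grading M) (H : grading N) (P : lmodType R)
    (B : int -> int -> M -> N -> P) : tensor -> P :=
  plift (fun p => gsum G (fun m x => gsum H (fun n y => B m n x y) p.2) p.1).

Section Lift.
Variables (G : grading M) (H : grading N) (P : lmodType R).
Variable B : int -> int -> M -> N -> P.
Hypothesis Bl : forall m n y, linear (B m n ^~ y).
Hypothesis Br : forall m n x, linear (B m n x).

Lemma htlift_compat : pcompat tens_rel
  (fun p => gsum G (fun m x => gsum H (fun n y => B m n x y) p.2) p.1).
Proof.
have lin := fglift_is_linear.
have linN (f : M * N -> P) u v : fglift f (u - v) = fglift f u - fglift f v.
  exact: lift_is_additive.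
have linZ (f : M * N -> P) c u : fglift f (c *: u) = c *: fglift f u.
  have f0 : fglift f 0 = 0 by have := linN f 0 0; rewrite !subrr.
  by have := lin _ _ _ f c u 0; rewrite f0 !addr0.
have linl y : linear (fun x => gsum G (fun m x => gsum H (fun n y => B m n x y) y) x).
  apply: gsum_is_linear => m c x x'.
  have [s us ys] := gproj_sum H y; have uy := gproj_notin us ys.
  rewrite !(gsum_seq _ us uy); do ?by move=> n; exact: Br.
  by rewrite scaler_sumr -big_split; apply: eq_bigr => n _; rewrite Bl.
have linr x : linear (fun y => gsum G (fun m x => gsum H (fun n y => B m n x y) y) x).
  move=> c y y'; have [s us xs] := gproj_sum G x; have ux := gproj_notin us xs.
  have lin1 m z : linear (fun x => gsum H (fun n y => B m n x y) z).
    move=> d w w'; have [t ut zt] := gproj_sum H z; have uz := gproj_notin ut zt.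
    rewrite !(gsum_seq _ ut uz); do ?by move=> n; exact: Br.
    by rewrite scaler_sumr -big_split; apply: eq_bigr => n _; rewrite Bl.
  rewrite !(gsum_seq _ us ux); do ?by move=> m; exact: lin1.
  rewrite scaler_sumr -big_split; apply: eq_bigr => m _.
  by apply: gsum_is_linear => n; exact: Br.
move=> _ [c x y z|c x y z]; rewrite !linN linZ !liftU !scale1r /=.
  by rewrite (linl z) addrAC addrK subrr.
by rewrite (linr z) addrAC addrK subrr.
Qed.

Lemma htlift_linear : linear (htlift G H B).
Proof. exact: plift_is_linear htlift_compat. Qed.

Lemma htlift_tens m n x y :
  homog G m x -> homog H n y -> htlift G H B (tens x y) = B m n x y.
Proof.
move=> hx hy; rewrite /htlift plift_gen; last exact: htlift_compat.
rewrite (gsum_homog _ hx) /=; first exact: gsum_homog.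
move=> k c u v; have [s us ys] := gproj_sum H y; have uy := gproj_notin us ys.
rewrite !(gsum_seq _ us uy); do ?by move=> l; exact: Br.
by rewrite scaler_sumr -big_split; apply: eq_bigr => l _; rewrite Bl.
Qed.

End Lift.
End Tensor.
Arguments tens {R M N} x y.

Section SymDef.
Variables (R : comNzRingType) (V : lmodType R) (G : grading V).

Definition letter : Type := {a : int * V | homog G a.1 a.2}.
HB.instance Definition _ := Choice.on letter.

Definition ldeg (a : letter) : int := (val a).1.
Definition lval (a : letter) : V := (val a).2.

Lemma lvalP (a : letter) : homog G (ldeg a) (lval a).
Proof. exact: valP a. Qed.

(* The letter of degree [n] with underlying element the degree [n] component
   of [x]; it is only used for [x] homogeneous of degree [n]. *)
Definition mkletter (n : int) (x : V) : letter :=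
  exist (fun a : int * V => homog G a.1 a.2) (n, gproj G n x)
        (homog_gproj G n x).

Definition wdeg (w : seq letter) : int := \sum_(a <- w) ldeg a.

(* The defining relations of the graded symmetric algebra on [V], as an
   [R]-module generated by the products of homogeneous elements of [V]. *)
Inductive sym_rel : {freeg (seq letter) / R} -> Prop :=
| SymLin u v n c x y :
    sym_rel (<< u ++ mkletter n (c *: x + y) :: v >>
             - c *: << u ++ mkletter n x :: v >> - << u ++ mkletter n y :: v >>)
| SymComm u v a b :
    sym_rel (<< u ++ a :: b :: v >>
             - ksign (ldeg a * ldeg b) *: << u ++ b :: a :: v >>).

Definition Sym : lmodType R := presented sym_rel.

Definition sw (w : seq letter) : Sym := pgen w.

Lemma sym_compat (N : lmodType R) (f : seq letter -> N) :
    (forall u v n c x y, f (u ++ mkletter n (c *: x + y) :: v) =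
       c *: f (u ++ mkletter n x :: v) + f (u ++ mkletter n y :: v)) ->
    (forall u v a b, f (u ++ a :: b :: v) =
       ksign (ldeg a * ldeg b) *: f (u ++ b :: a :: v)) ->
  pcompat sym_rel f.
Proof.
move=> flin fcomm.
have linN u v : fglift f (u - v) = fglift f u - fglift f v.
  exact: lift_is_additive.
have linZ c u : fglift f (c *: u) = c *: fglift f u.
  have f0 : fglift f 0 = 0 by have := linN 0 0; rewrite !subrr.
  by have := fglift_is_linear f c u 0; rewrite f0 !addr0.
move=> _ [u v n c x y|u v a b]; rewrite !linN linZ !liftU !scale1r.
  by rewrite flin addrAC addrK subrr.
by rewrite fcomm subrr.
Qed.

Lemma sw_lin u v n c x y : sw (u ++ mkletter n (c *: x + y) :: v) =
  c *: sw (u ++ mkletter n x :: v) + sw (u ++ mkletter n y :: v).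
Proof.
have /pres_span_rel := SymLin u v n c x y; rewrite -addrA -opprD => /pclassP.
by rewrite /sw /pgen => ->; rewrite linearP.
Qed.

Lemma sw_comm u v a b :
  sw (u ++ a :: b :: v) = ksign (ldeg a * ldeg b) *: sw (u ++ b :: a :: v).
Proof.
have /pres_span_rel/pclassP := SymComm u v a b.
by rewrite /sw /pgen => ->; rewrite linearZ.
Qed.

Lemma wdeg_cat u v : wdeg (u ++ v) = wdeg u + wdeg v.
Proof. by rewrite /wdeg big_cat. Qed.

Lemma wdeg_cons a w : wdeg (a :: w) = ldeg a + wdeg w.
Proof. by rewrite /wdeg big_cons. Qed.

Lemma filter_compat (P : seq letter -> bool) :
    (forall u v n x y, P (u ++ mkletter n x :: v) = P (u ++ mkletter n y :: v)) ->
    (forall u v a b, P (u ++ a :: b :: v) = P (u ++ b :: a :: v)) ->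
  pcompat sym_rel (fun w => if P w then sw w else 0).
Proof.
move=> Plin Pcomm; apply: sym_compat => [u v n c x y|u v a b].
  rewrite (Plin u v n _ x) (Plin u v n y x).
  by case: (P _); rewrite ?scaler0 ?addr0 // sw_lin.
by rewrite Pcomm; case: (P _); rewrite ?scaler0 // sw_comm.
Qed.

Definition sproj (n : int) : Sym -> Sym :=
  plift (fun w => if wdeg w == n then sw w else 0).

Lemma sproj_compat n :
  pcompat sym_rel (fun w => if wdeg w == n then sw w else 0).
Proof.
apply: filter_compat => [u v k x y|u v a b]; rewrite !wdeg_cat !wdeg_cons //.
by rewrite (addrCA (ldeg a)).
Qed.

Lemma sproj_is_linear n : linear (sproj n).
Proof. exact: plift_is_linear (@sproj_compat n). Qed.

HB.instance Definition _ n :=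
  GRing.isLinear.Build R Sym Sym *:%R (sproj n) (sproj_is_linear n).

Lemma sproj_sw n w : sproj n (sw w) = if wdeg w == n then sw w else 0.
Proof. exact: (plift_gen (@sproj_compat n)). Qed.

Fact sprojE m n (x : Sym) :
  sproj m (sproj n x) = if m == n then sproj n x else 0.
Proof.
elim/pres_ind: x => [|c w x ih]; first by rewrite !raddf0; case: ifP.
rewrite !linearP /= ih -/(sw w) sproj_sw.
have [<-|ne] := eqVneq (wdeg w) n.
  by rewrite sproj_sw eq_sym; case: ifP => _; rewrite ?scaler0 ?addr0.
by rewrite raddf0 scaler0 !add0r.
Qed.

Fact sproj_sum (x : Sym) :
  exists2 s : seq int, uniq s & x = \sum_(n <- s) sproj n x.
Proof.
suff [s us hs] : exists2 s : seq int, uniq s &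
    forall t, uniq t -> {subset s <= t} -> x = \sum_(n <- t) sproj n x.
  by exists s => //; exact: hs.
elim/pres_ind: x => [|c w x [s us ih]].
  by exists [::] => // t _ _; rewrite big1 // => n _; rewrite raddf0.
exists (undup (wdeg w :: s)) => [|t ut st]; first exact: undup_uniq.
have wt : wdeg w \in t by apply: st; rewrite mem_undup mem_head.
have {}ih : x = \sum_(n <- t) sproj n x.
  by apply: ih => // n ns; apply: st; rewrite mem_undup inE ns orbT.
under eq_bigr => n _ do rewrite linearP /= -/(sw w) sproj_sw.
rewrite big_split -ih -scaler_sumr; congr (c *: _ + _).
rewrite (bigD1_seq (wdeg w)) //= eqxx big1 ?addr0 // => n.
by rewrite eq_sym => /negbTE ->.
Qed.

Definition sgrading : grading Sym :=
  @Grading R Sym (fun n => sproj n : {linear Sym -> Sym}) sprojE sproj_sum.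

Lemma homog_sw w : homog sgrading (wdeg w) (sw w).
Proof. by rewrite /homog /= sproj_sw eqxx. Qed.

Definition wproj (k : nat) : Sym -> Sym :=
  plift (fun w => if size w == k then sw w else 0).

(* The coaugmentation filtration, with a shift by one of the index:
   [coaug k] is the sum of the [S^i] for [i < k], so that [coaug 0 = 0]. *)
Definition coaug (k : nat) (x : Sym) : Prop := \sum_(i < k) wproj i x = x.

(* The projection onto [S^1 = V]. *)
Definition corest : Sym -> V :=
  plift (fun w => if w is [:: a] then lval a else 0).

Definition lmul (a : letter) : Sym -> Sym := plift (fun w => sw (a :: w)).

Definition counit : Sym -> R^o := plift (fun w => (nilp w)%:R : R^o).

(* The shuffle diagonal: the morphism of graded algebras for which the
   elements of [V] are primitive.  It is computed by
   [Delta (a w) = (a (x) 1 + 1 (x) a) Delta w], where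
   [(1 (x) a) (x (x) y) = (-1)^(|a||x|) x (x) a y]. *)
Definition diag_step (a : letter) : tensor Sym Sym -> tensor Sym Sym :=
  htlift sgrading sgrading
    (fun m _ x y => tens (lmul a x) y + ksign (ldeg a * m) *: tens x (lmul a y)).

Definition sdiag : Sym -> tensor Sym Sym :=
  plift (fun w => foldr diag_step (tens (sw [::]) (sw [::])) w).

(* [conv B x] is the sum of the [B |x'| |x''| x' x''] for
   [Delta x = sum x' (x) x''] with [x'] and [x''] homogeneous. *)
Definition conv (N : lmodType R) (B : int -> int -> Sym -> Sym -> N) (x : Sym) : N :=
  htlift sgrading sgrading B (sdiag x).

Lemma wproj_compat k :
  pcompat sym_rel (fun w => if size w == k then sw w else 0).
Proof. by apply: filter_compat => *; rewrite !size_cat. Qed.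

Lemma wproj_sw k w : wproj k (sw w) = if size w == k then sw w else 0.
Proof. exact: (plift_gen (@wproj_compat k)). Qed.

Lemma wproj_is_linear k : linear (wproj k).
Proof. exact: plift_is_linear (@wproj_compat k). Qed.

Lemma corest_compat :
  pcompat sym_rel (fun w => if w is [:: a] then lval a else 0).
Proof.
apply: sym_compat => [u v n c x y|u v a b].
  case: u => [|b [|b' u]] /=; case: v => *; rewrite ?scaler0 ?addr0 //.
  by rewrite /lval /= linearP.
by case: u => [|c [|c' u]] /=; rewrite ?scaler0.
Qed.

Lemma corest_sw w : corest (sw w) = if w is [:: a] then lval a else 0.
Proof. exact: (plift_gen corest_compat). Qed.

Lemma corest_is_linear : linear corest.
Proof. exact: plift_is_linear corest_compat. Qed.

Lemma lmul_compat a : pcompat sym_rel (fun w => sw (a :: w)).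
Proof.
by apply: sym_compat => [u v n c x y|u v b d];
  [exact: (sw_lin (a :: u))|exact: (sw_comm (a :: u))].
Qed.

Lemma lmul_sw a w : lmul a (sw w) = sw (a :: w).
Proof. exact: (plift_gen (@lmul_compat a)). Qed.

Lemma lmul_is_linear a : linear (lmul a).
Proof. exact: plift_is_linear (@lmul_compat a). Qed.

Lemma counit_compat : pcompat sym_rel (fun w => (nilp w)%:R : R^o).
Proof.
by apply: sym_compat => [[|? ?] v n c x y|[|? ?] v a b] /=;
  rewrite scaler0 ?addr0.
Qed.

Lemma counit_sw w : counit (sw w) = (nilp w)%:R.
Proof. exact: (plift_gen counit_compat). Qed.

Lemma linear_sym_ext (N : lmodType R) (f g : Sym -> N) : linear f -> linear g ->
  (forall w, f (sw w) = g (sw w)) -> forall x, f x = g x.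
Proof.
move=> flin glin fg; elim/pres_ind => [|c w x ih]; first by rewrite !lin_fun0.
by rewrite flin glin ih -/(sw w) fg.
Qed.

Lemma linear_tens_ext (N : lmodType R) (f g : tensor Sym Sym -> N) :
    linear f -> linear g ->
    (forall u v, f (tens (sw u) (sw v)) = g (tens (sw u) (sw v))) ->
  forall z, f z = g z.
Proof.
move=> flin glin fg; elim/pres_ind => [|c [x y] z ih]; first by rewrite !lin_fun0.
rewrite flin glin ih; congr (c *: _ + _); rewrite -[pgen _]/(tens x y).
have cl (h : tensor Sym Sym -> N) y' : linear h -> linear (fun x => h (tens x y')).
  by move=> hlin d a b; rewrite tens_linl hlin.
have cr (h : tensor Sym Sym -> N) x' : linear h -> linear (fun y => h (tens x' y)).
  by move=> hlin d a b; rewrite tens_linr hlin.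
move: x; apply: (linear_sym_ext (cl f y flin) (cl g y glin)) => u.
by move: y; apply: (linear_sym_ext (cr f _ flin) (cr g _ glin)) => v.
Qed.

Lemma diag_step_bil a m :
  (forall y, linear (fun x =>
     tens (lmul a x) y + ksign (ldeg a * m) *: tens x (lmul a y))) /\
  (forall x, linear (fun y =>
     tens (lmul a x) y + ksign (ldeg a * m) *: tens x (lmul a y))).
Proof.
have comm (r q : R) (z : tensor Sym Sym) : r *: (q *: z) = q *: (r *: z).
  by rewrite !scalerA mulrC.
split=> [y|x] c z z'.
  rewrite lmul_is_linear !tens_linl !scalerDr (comm _ c).
  by rewrite addrACA.
rewrite lmul_is_linear !tens_linr !scalerDr (comm _ c).
by rewrite addrACA.
Qed.

Lemma diag_step_is_linear a : linear (diag_step a).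
Proof.
by apply: htlift_linear => m n z; [exact: (diag_step_bil a m).1|
  exact: (diag_step_bil a m).2].
Qed.

Lemma diag_step_sw a u v : diag_step a (tens (sw u) (sw v)) =
  tens (sw (a :: u)) (sw v) + ksign (ldeg a * wdeg u) *: tens (sw u) (sw (a :: v)).
Proof.
rewrite /diag_step (htlift_tens _ _ (homog_sw u) (homog_sw v)) ?lmul_sw //.
  by move=> m n z; exact: (diag_step_bil a m).1.
by move=> m n z; exact: (diag_step_bil a m).2.
Qed.

Lemma diag_step_lin n c x y z : diag_step (mkletter n (c *: x + y)) z =
  c *: diag_step (mkletter n x) z + diag_step (mkletter n y) z.
Proof.
have lin x' : linear (diag_step (mkletter n x')) by exact: diag_step_is_linear.
move: z; apply: linear_tens_ext => [//|d z z'|u v].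
  rewrite !lin !scalerDr addrACA; congr (_ + _).
  by rewrite !scalerA mulrC.
rewrite !diag_step_sw /ldeg /= (sw_lin [::]) tens_linl (sw_lin [::]) tens_linr.
rewrite !scalerDr addrACA; congr (_ + _); congr (_ + _).
by rewrite !scalerA mulrC.
Qed.

Lemma diag_step_comm a b z : diag_step a (diag_step b z) =
  ksign (ldeg a * ldeg b) *: diag_step b (diag_step a z).
Proof.
have lin b' := @diag_step_is_linear b'; have lin0 b' : diag_step b' 0 = 0.
  exact: lin_fun0 (lin b').
have linD b' z1 z2 : diag_step b' (z1 + z2) = diag_step b' z1 + diag_step b' z2.
  by rewrite -[z1]scale1r lin !scale1r.
have linZ b' d z1 : diag_step b' (d *: z1) = d *: diag_step b' z1.
  by rewrite -[d *: z1]addr0 lin lin0 addr0.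
have tl0 (x : Sym) : tens 0 x = 0 :> tensor Sym Sym.
  exact: (lin_fun0 (tens_linl x)).
have tr0 (x : Sym) : tens x 0 = 0 :> tensor Sym Sym.
  exact: (lin_fun0 (tens_linr x)).
have tlZ (d : R) (x y : Sym) : tens (d *: x) y = d *: tens x y.
  by have := tens_linl y d x 0; rewrite tl0 !addr0.
have trZ (d : R) (x y : Sym) : tens x (d *: y) = d *: tens x y.
  by have := tens_linr x d y 0; rewrite tr0 !addr0.
move: z; apply: linear_tens_ext => [d z z'|d z z'|u v].
- by rewrite !lin.
- by rewrite !lin scalerDr !scalerA [_ * d]mulrC.
rewrite !diag_step_sw !linD !linZ !diag_step_sw !wdeg_cons.
rewrite (sw_comm [::] u a b) (sw_comm [::] v a b) tlZ trZ /=.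
have sq (k : int) := ksignMK R k.
rewrite !scalerDr !scalerA -!addrA; congr (_ + _).
rewrite !mulrDr !ksignD; set e := ksign (ldeg a * ldeg b).
have eb : ksign (ldeg b * ldeg a) = e :> R by rewrite /e mulrC.
rewrite eb addrCA !mulrA sq mul1r; congr (_ + (_ + _ *: _)).
by rewrite mulrAC [RHS]mulrC mulrA [_ * e]mulrC.
Qed.

Lemma sdiag_compat :
  pcompat sym_rel (fun w => foldr diag_step (tens (sw [::]) (sw [::])) w).
Proof.
apply: sym_compat => [u v n c x y|u v a b]; rewrite !foldr_cat /=.
  rewrite diag_step_lin; elim: u => //= d u ->; exact: diag_step_is_linear.
rewrite diag_step_comm; elim: u => //= d u ->.
have lin := @diag_step_is_linear d; have lin0 : diag_step d 0 = 0.
  exact: lin_fun0 lin.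
by rewrite -[X in diag_step d X]addr0 lin lin0 addr0.
Qed.

Lemma sdiag_is_linear : linear sdiag.
Proof. exact: plift_is_linear sdiag_compat. Qed.

Lemma sdiag_nil : sdiag (sw [::]) = tens (sw [::]) (sw [::]).
Proof. exact: (plift_gen sdiag_compat). Qed.

Lemma sdiag_cons a w : sdiag (sw (a :: w)) = diag_step a (sdiag (sw w)).
Proof. by rewrite /sdiag !(plift_gen sdiag_compat). Qed.

Definition is_coder (f : Sym -> Sym) : Prop :=
  [/\ linear f, degree_map sgrading sgrading (-1) f &
      forall x, sdiag (f x) =
        conv (fun m _ x' x'' => tens (f x') x'' + ksign m *: tens x' (f x'')) x].

(* The coderivation of degree [-1] with corestriction [h : Sym -> V], that is,
   the composite of [Delta], [h (x) id] and the multiplication. *)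
Definition coder_of (h : Sym -> V) : Sym -> Sym :=
  conv (fun m _ x' x'' => lmul (mkletter (m - 1) (h x')) x'').

Definition is_filtered_coder (f : Sym -> Sym) : Prop :=
  is_coder f /\ forall k x, coaug k.+1 x -> coaug k (f x).

(* The constituent [S^(j+1) -> V] of [f], extended by zero, and the
   coderivation that it determines. *)
Definition constituent (f : Sym -> Sym) (j : nat) (x : Sym) : V :=
  corest (f (wproj j.+1 x)).

Definition coder_comp (f : Sym -> Sym) (j : nat) : Sym -> Sym :=
  coder_of (constituent f j).

End SymDef.

(* The homogeneous maps of [Hom(S[sL], A)] do not span the module of all maps.
   A graded module is therefore also given by a family of submodules [comp p]
   of an ambient module; only the elements of some [comp p] are meaningful, and
   the operations take the degrees of their arguments as parameters. *)
Section GradedAlgebra.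
Variables (R : comNzRingType) (T : lmodType R) (comp : int -> T -> Prop).
Variable mul : int -> int -> T -> T -> T.

Definition is_gr_linear (k : int) (f : int -> T -> T) : Prop :=
  (forall p x, comp p x -> comp (p + k) (f p x)) /\
  (forall p c x y, comp p x -> comp p y ->
     f p (c *: x + y) = c *: f p x + f p y).

Definition is_gr_der (k : int) (f : int -> T -> T) : Prop :=
  is_gr_linear k f /\
  (forall p q x y, comp p x -> comp q y ->
     f (p + q) (mul p q x y) =
       mul (p + k) q (f p x) y + ksign (k * p) *: mul p (q + k) x (f q y)).

Definition is_differential (f : int -> T -> T) : Prop :=
  is_gr_linear (-1) f /\ (forall p x, comp p x -> f (p - 1) (f p x) = 0).

Record is_cdga (one : T) (d : int -> T -> T) : Prop := IsCdga {
  cdga_comp0 : forall p, comp p 0;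
  cdga_compP : forall p c x y, comp p x -> comp p y -> comp p (c *: x + y);
  cdga_mul : forall p q x y, comp p x -> comp q y -> comp (p + q) (mul p q x y);
  cdga_mulDl : forall p q c x x' y, comp p x -> comp p x' -> comp q y ->
    mul p q (c *: x + x') y = c *: mul p q x y + mul p q x' y;
  cdga_mulDr : forall p q c x y y', comp p x -> comp q y -> comp q y' ->
    mul p q x (c *: y + y') = c *: mul p q x y + mul p q x y';
  cdga_mulA : forall p q r x y z, comp p x -> comp q y -> comp r z ->
    mul p (q + r) x (mul q r y z) = mul (p + q) r (mul p q x y) z;
  cdga_mulC : forall p q x y, comp p x -> comp q y ->
    mul p q x y = ksign (p * q) *: mul q p y x;
  cdga_one : comp 0 one;
  cdga_mul1 : forall p x, comp p x -> mul 0 p one x = x;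
  cdga_der : is_gr_der (-1) d;
  cdga_dd : is_differential d
}.

End GradedAlgebra.

(* The operators [md_D j], for [j >= 0], include the differential [md_D 0]. *)
Record mdca_data (R : comNzRingType) := MdcaData {
  md_car : lmodType R;
  md_comp : int -> md_car -> Prop;
  md_mul : int -> int -> md_car -> md_car -> md_car;
  md_one : md_car;
  md_fil : nat -> md_car -> Prop;
  md_D : nat -> int -> md_car -> md_car
}.

Section MultiDerivation.
Variables (R : comNzRingType) (X : mdca_data R).
Local Notation comp := (@md_comp R X).
Local Notation fil := (@md_fil R X).
Local Notation D := (@md_D R X).

Definition fil_limit (p : int) (u : nat -> md_car X) (x : md_car X) : Prop :=
  comp p x /\
  forall l, exists N, forall n, (N <= n)%N -> fil l (x - u n).

Definition fil_complete : Prop := forall p (u : nat -> md_car X),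
  (forall n, comp p (u n)) ->
  (forall l, exists N, forall m n, (N <= m)%N -> (N <= n)%N -> fil l (u m - u n)) ->
  exists! x, fil_limit p u x.

Definition partial_sum (p : int) (x : md_car X) (n : nat) : md_car X :=
  \sum_(1 <= j < n) D j p x.

(* [E] is the sum of the [D j] with [j >= 1], the series being finite on each
   element, or convergent for the filtration, which is then complete. *)
Definition naive_sum (E : int -> md_car X -> md_car X) : Prop :=
  forall p x, comp p x ->
    exists N, forall n, (N <= n)%N -> partial_sum p x n = E p x.

Definition fil_sum (E : int -> md_car X -> md_car X) : Prop :=
  fil_complete /\
  forall p x, comp p x -> fil_limit (p - 1) (partial_sum p x) (E p x).

Record is_mdca : Prop := IsMdca {
  mdca_cdga : is_cdga comp (@md_mul R X) (md_one X) (D 0%N);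
  mdca_fil0 : forall p x, comp p x -> fil 0%N x;
  mdca_fil_desc : forall l p x, comp p x -> fil l.+1 x -> fil l x;
  mdca_fil_sub0 : forall l, fil l 0;
  mdca_fil_sub : forall l p c x y, comp p x -> comp p y ->
    fil l x -> fil l y -> fil l (c *: x + y);
  mdca_fil_D0 : forall l p x, comp p x -> fil l x -> fil l (D 0%N p x);
  mdca_der : forall j, (0 < j)%N -> is_gr_der comp (@md_mul R X) (-1) (D j);
  mdca_lower : forall j, (0 < j)%N ->
    forall l p x, comp p x -> fil l x -> fil (l + j)%N (D j p x);
  mdca_sharp : forall j, (0 < j)%N ->
    (exists p x, comp p x /\ D j p x <> 0) ->
    ~ (forall l p x, comp p x -> fil l x -> fil (l + j.+1)%N (D j p x));
  mdca_sum : exists E, (naive_sum E \/ fil_sum E) /\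
    is_differential comp (fun p x => D 0%N p x + E p x)
}.

End MultiDerivation.

Record cdga (R : comNzRingType) := Cdga {
  cdga_car :> algType R;
  cdga_gr : grading cdga_car;
  cdga_d : {linear cdga_car -> cdga_car};
  cdgaP : is_cdga (homog cdga_gr) (fun _ _ => *%R) 1 (fun _ => cdga_d)
}.

Record dgModule (R : comNzRingType) (A : cdga R) := DgModule {
  dgm_car :> lmodType R;
  dgm_gr : grading dgm_car;
  dgm_act : A -> dgm_car -> dgm_car;
  dgm_d : {linear dgm_car -> dgm_car};
  dgm_actl : forall x, linear (fun a : A => dgm_act a x);
  dgm_actr : forall a, linear (dgm_act a);
  dgm_act_deg : forall m n a x, homog (cdga_gr A) m a -> homog dgm_gr n x ->
    homog dgm_gr (m + n) (dgm_act a x);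
  dgm_act1 : forall x, dgm_act 1 x = x;
  dgm_actA : forall m n a b x, homog (cdga_gr A) m a -> homog (cdga_gr A) n b ->
    dgm_act (a * b) x = dgm_act a (dgm_act b x);
  dgm_d_deg : degree_map dgm_gr dgm_gr (-1) dgm_d;
  dgm_dd : forall x, dgm_d (dgm_d x) = 0;
  dgm_d_act : forall m a x, homog (cdga_gr A) m a ->
    dgm_d (dgm_act a x) =
      dgm_act (cdga_d A a) x + ksign m *: dgm_act a (dgm_d x)
}.

Section Suspension.
Variables (R : comNzRingType) (A : cdga R) (L : dgModule A).

(* The elements of [L] serve as the elements of [sL], [x] standing for [s x]. *)
Fact susp_projE m n (x : L) :
  gproj (dgm_gr L) (m - 1) (gproj (dgm_gr L) (n - 1) x) =
    if m == n then gproj (dgm_gr L) (n - 1) x else 0.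
Proof. by rewrite gprojE (inj_eq (addIr _)). Qed.

Fact susp_proj_sum (x : L) : exists2 s : seq int,
  uniq s & x = \sum_(n <- s) gproj (dgm_gr L) (n - 1) x.
Proof.
have [s us {1}->] := gproj_sum (dgm_gr L) x.
exists [seq n + 1 | n <- s]; first by rewrite map_inj_uniq //; exact: addIr.
by rewrite big_map; apply: eq_bigr => n _; rewrite addrK.
Qed.

Definition susp_gr : grading L := Grading susp_projE susp_proj_sum.

Lemma susp_homog n (x : L) : homog susp_gr n x = homog (dgm_gr L) (n - 1) x.
Proof. by []. Qed.

(* [a (s x) = (-1)^|a| s (a x)] and [d (s x) = - s (d x)]. *)
Definition susp_act (a : A) (x : L) : L :=
  gsum (cdga_gr A) (fun m b => ksign m *: dgm_act b x) a.

Definition susp_d (x : L) : L := - dgm_d L x.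

Fact susp_d_is_linear : linear susp_d.
Proof. by move=> c x y; rewrite /susp_d linearP opprD scalerN. Qed.

HB.instance Definition _ :=
  GRing.isLinear.Build R L L *:%R susp_d susp_d_is_linear.

Let Flin (x : L) (m : int) : linear (fun b : A => ksign m *: dgm_act b x).
Proof. by move=> c a b; rewrite dgm_actl scalerDr !scalerA mulrC. Qed.

Lemma susp_actE m (a : A) x :
  homog (cdga_gr A) m a -> susp_act a x = ksign m *: dgm_act a x.
Proof. exact: gsum_homog (Flin x) _ _. Qed.

Fact susp_actl x : linear (fun a : A => susp_act a x).
Proof. exact: gsum_is_linear (Flin x). Qed.

Fact susp_actr a : linear (susp_act a).
Proof.
move=> c x y; have [s us as_] := gproj_sum (cdga_gr A) a.
have ua := gproj_notin us as_.
rewrite /susp_act !(gsum_seq (Flin _) us ua) scaler_sumr -big_split.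
by apply: eq_bigr => m _; rewrite dgm_actr scalerDr !scalerA mulrC.
Qed.

Fact susp_act_deg m n a x : homog (cdga_gr A) m a -> homog susp_gr n x ->
  homog susp_gr (m + n) (susp_act a x).
Proof.
move=> ha hx; rewrite (susp_actE _ ha) /homog linearZ /= -addrA.
by rewrite (eqP (dgm_act_deg ha hx)).
Qed.

Fact susp_act1 x : susp_act 1 x = x.
Proof. by rewrite (susp_actE _ (cdga_one (cdgaP A))) dgm_act1 scale1r. Qed.

Fact susp_actA m n a b x : homog (cdga_gr A) m a -> homog (cdga_gr A) n b ->
  susp_act (a * b) x = susp_act a (susp_act b x).
Proof.
move=> ha hb; have hab := cdga_mul (cdgaP A) ha hb.
rewrite (susp_actE _ ha) (susp_actE _ hb) (susp_actE _ hab) (dgm_actA _ ha hb).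
have := @dgm_actr _ _ L a (ksign n) (dgm_act b x) 0.
rewrite (lin_fun0 (@dgm_actr _ _ L a)) !addr0 => ->.
by rewrite scalerA ksignD.
Qed.

Fact susp_d_deg : degree_map susp_gr susp_gr (-1) susp_d.
Proof.
move=> n x hx; rewrite /homog /susp_d linearN /= addrAC.
by rewrite (eqP (dgm_d_deg hx)).
Qed.

Fact susp_dd x : susp_d (susp_d x) = 0.
Proof. by rewrite /susp_d linearN /= dgm_dd !oppr0. Qed.

Fact susp_d_act m a x : homog (cdga_gr A) m a ->
  susp_d (susp_act a x) =
    susp_act (cdga_d A a) x + ksign m *: susp_act a (susp_d x).
Proof.
move=> ha; have hda := (cdga_der (cdgaP A)).1.1 _ _ ha.
rewrite !(susp_actE _ ha) (susp_actE _ hda) /susp_d linearZ /= (dgm_d_act _ ha).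
have := @dgm_actr _ _ L a (-1) (dgm_d L x) 0.
rewrite (lin_fun0 (@dgm_actr _ _ L a)) !addr0 !scaleN1r => ->.
rewrite ksignD ksignN ksign1 mulrN1 scalerDr opprD scaleNr; congr (_ + _).
by rewrite !scalerN.
Qed.

Definition susp : dgModule A := @DgModule R A L susp_gr susp_act susp_d
  susp_actl susp_actr susp_act_deg susp_act1 susp_actA susp_d_deg susp_dd
  susp_d_act.

End Suspension.

Section DoubleDual.
Variables (R : comNzRingType) (A : cdga R) (L : dgModule A).

(* The degree [p] component of [Hom_A(L, A)]. *)
Definition dual_form (p : int) (phi : L -> A) : Prop :=
  [/\ linear phi, degree_map (dgm_gr L) (cdga_gr A) p phi &
      forall m a x, homog (cdga_gr A) m a ->
        phi (dgm_act a x) = ksign (m * p) *: (a * phi x)].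

(* The image of [x], of degree [n], in the double dual, evaluated at a form of
   degree [p]. *)
Definition bidual (n : int) (x : L) (p : int) (phi : L -> A) : A :=
  ksign (n * p) *: phi x.

Definition bidual_injective : Prop := forall n x y,
  homog (dgm_gr L) n x -> homog (dgm_gr L) n y ->
  (forall p phi, dual_form p phi -> bidual n x p phi = bidual n y p phi) ->
  x = y.

End DoubleDual.

Section ShLieRinehart.
Variables (R : comNzRingType) (iota : {rmorphism rat -> R}).
Variables (A : cdga R) (L : dgModule A).

Local Notation sL := (susp L).
Local Notation grA := (cdga_gr A).
Local Notation grL := (dgm_gr sL).
Local Notation act := (@dgm_act R A sL).
Local Notation S := (Sym grL).
Local Notation grS := (sgrading grL).

(* The degree [k] component of [Der(A|R)], and the graded commutator of maps
   of degrees [p] and [q]. *)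
Definition is_der (k : int) (delta : A -> A) : Prop :=
  linear delta /\ is_gr_der (homog grA) (fun _ _ => *%R) k (fun _ => delta).

Definition der_bracket (p q : int) (f g : A -> A) : A -> A :=
  fun b => f (g b) - ksign (p * q) *: g (f b).

Definition sym_d0 : S -> S := coder_of (fun x => dgm_d sL (corest x)).

(* The Hom-differential of a map of degree [p]. *)
Definition hom_diff (N : lmodType R) (dS : S -> S) (dN : N -> N) (p : int)
  (f : S -> N) (x : S) : N := dN (f x) + ksign (p + 1) *: f (dS x).

Section Data.
Variables (par : S -> S) (t : S -> A -> A).

Definition tcomp (j : nat) (x : S) : A -> A := t (wproj j x).

Definition is_filtered_morphism : Prop :=
  [/\ linear t, forall n x, homog grS n x -> is_der (n - 1) (t x) &
      t (sw [::]) = 0].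

Definition total_d (x : S) : S := sym_d0 x + par x.

(* [1/2 [t, t]]; the sign is that of
   [(t (x) t) (x' (x) x'') = (-1)^(|t||x'|) t x' (x) t x'']. *)
Definition twedge (x : S) : A -> A :=
  iota (2%:R^-1) *:
    conv (fun m n x' x'' =>
      ksign (-1 * m) *: der_bracket (m - 1) (n - 1) (t x') (t x'')) x.

Definition is_sh_lie : Prop :=
  is_filtered_coder par /\ forall x, total_d (total_d x) = 0.

Definition is_sh_action : Prop :=
  is_filtered_morphism /\
  forall n x, homog grS n x ->
    hom_diff total_d (der_bracket (-1) (n - 1) (cdga_d A)) (-1) t x + twedge x = 0.

(* The letter [a alpha], for [a] of degree [m]. *)
Definition lact (m : int) (a : A) (alpha : letter grL) : letter grL :=
  mkletter grL (m + ldeg alpha) (act a (lval alpha)).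

Definition is_multilinear (N : lmodType R) (actN : A -> N -> N) (p : int)
    (f : S -> N) : Prop :=
  forall m a u alpha v, homog grA m a ->
    f (sw (u ++ lact m a alpha :: v)) =
      ksign (m * (p + wdeg u)) *: actN a (f (sw (u ++ alpha :: v))).

Definition der_act (a : A) (delta : A -> A) : A -> A := fun b => a * delta b.

Record is_sh_lie_rinehart : Prop := IsShLieRinehart {
  shlr_lie : is_sh_lie;
  shlr_action : is_sh_action;
  shlr_multilinear : forall j, (0 < j)%N ->
    is_multilinear der_act (-1) (tcomp j);
  shlr_leibniz : forall (j : nat) (w : seq (letter grL)) alpha m a,
    (0 < j)%N -> size w = j -> homog grA m a ->
    constituent par j (sw (rcons w (lact m a alpha))) =
      act (tcomp j (sw w) a) (lval alpha)
      + ksign ((wdeg w + 1) * m) *: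
          act a (constituent par j (sw (rcons w alpha)))
}.

(* The degree [p] component of [Sym_A(sL, A)]. *)
Definition sym_form (p : int) (phi : S -> A) : Prop :=
  [/\ linear phi, degree_map grS grA p phi &
      is_multilinear (fun a b : A => a * b) p phi].

Definition cup (p q : int) (phi psi : S -> A) : S -> A :=
  conv (fun m _ x' x'' => ksign (q * m) *: (phi x' * psi x'')).

Definition cup_one : S -> A := fun x => (counit x : R) *: 1.

Definition sym_fil (l : nat) (phi : S -> A) : Prop :=
  forall x, coaug l x -> phi x = 0.

Definition par_t (j : nat) (p : int) (phi : S -> A) : S -> A :=
  conv (fun m _ x' x'' => ksign (p * m) *: tcomp j x' (phi x'')).

Definition par_star (j : nat) (p : int) (phi : S -> A) : S -> A :=
  fun x => ksign (p + 1) *: phi (coder_comp par j x).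

Definition sym_D0 (p : int) (phi : S -> A) : S -> A :=
  hom_diff sym_d0 (cdga_d A) p phi.

Definition sym_Dj (j : nat) (p : int) (phi : S -> A) : S -> A :=
  fun x => par_t j p phi x + par_star j p phi x.

Definition sym_D (j : nat) : int -> (S -> A) -> (S -> A) :=
  if j is 0%N then sym_D0 else sym_Dj j.

Definition passes_to_sym (f : int -> (S -> A) -> (S -> A)) : Prop :=
  forall p phi, sym_form p phi -> sym_form (p - 1) (f p phi).

Definition sym_data (D : nat -> int -> (S -> A) -> (S -> A)) : mdca_data R :=
  @MdcaData R (S -> A) sym_form cup cup_one sym_fil D.

End Data.
End ShLieRinehart.

Record shLieRinehart (R : comNzRingType) (iota : {rmorphism rat -> R}) :=
ShLieRinehart {
  shlr_A : cdga R;
  shlr_L : dgModule shlr_A;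
  shlr_par : Sym (dgm_gr (susp shlr_L)) -> Sym (dgm_gr (susp shlr_L));
  shlr_t : Sym (dgm_gr (susp shlr_L)) -> shlr_A -> shlr_A;
  shlrP : is_sh_lie_rinehart iota shlr_par shlr_t
}.

Definition maurer_cartan_algebra (R : comNzRingType)
    (iota : {rmorphism rat -> R}) (X : shLieRinehart iota) : mdca_data R :=
  sym_data (sym_D (@shlr_par R iota X) (@shlr_t R iota X)).

(* Main.v *)
(* Every D_j, the differential D_0, and the sum of all of them are instances of
   one operator [coder_act tau h]: phi maps to tau . phi plus or minus phi o H,
   where H is the coderivation with corestriction h.  Such an operator is always
   a derivation of the cup product.  It preserves the A-multilinear forms as
   soon as tau is A-multilinear and h satisfies the Leibniz rule over tau;
   conversely, evaluating it on the constants a in A gives the multilinearity of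
   tau, and evaluating it on the A-linear forms on sL, which separate points by
   the hypothesis on the double dual, gives the Leibniz rule.  Its square is
   T . phi - phi o H o H with T = tau H + (tau composed with itself along the
   diagonal), which for the total operator is the left-hand side of the twisting
   cochain equation.  Constants detect T, linear forms then detect the
   corestriction of H o H, and a coderivation with zero corestriction vanishes
   because R contains the rationals. *)
Require Import Defs.
From mathcomp Require Import all_boot all_order all_algebra.
From mathcomp Require Import zify.
From mathcomp Require Import boolp functions.

Set Implicit Arguments.
Unset Strict Implicit.
Unset Printing Implicit Defensive.

Import GRing.Theory.
Local Open Scope ring_scope.

(** Identities are checked on words, where the diagonal becomes the signed sum [unsh] over
    unshuffles of an arbitrary function; its coassociativity, cocommutativity and counit are then
    combinatorial and need no well-definedness on the quotient [Sym].

    The data of a multi derivation chain algebra speak at two levels. Passing to multilinear forms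
    is a condition on each [D_j], and yields multilinearity and the Leibniz rule weight by weight.
    Being a differential is a condition on the sum only, so the twisting equation and the vanishing
    of the square come from the total operator at once. That sum is given only as some [E], which is
    identified by evaluation on words, where the series is finite. Starting it at [j = 1] loses
    nothing: [t] vanishes on the empty word, and the corestriction of the coderivation vanishes on
    words of length at most one.

    The equations for [T] and for [H o H] decouple because [H] takes values in words of positive
    length, where constants vanish. Sharpness of the filtration shift is automatic: [D_j] changes
    word length by exactly [j], so a deeper shift forces [D_j = 0]. *)

Section Parity.

(** Signs depend only on parities, and parity turns sums and products of degrees into exclusive or
    and conjunction. [ksolve] merges the signs and decides each Koszul identity over all
    parities. *)
Definition zodd (n : int) : bool := odd `|n|%N.

Lemma zoddD m n : zodd (m + n) = zodd m (+) zodd n.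
Proof. by rewrite /zodd; case: m n => [m|m] [n|n]; lia. Qed.

Lemma zoddM m n : zodd (m * n) = zodd m && zodd n.
Proof. by rewrite /zodd abszM oddM. Qed.

Lemma zoddN n : zodd (- n) = zodd n.
Proof. by rewrite /zodd abszN. Qed.

Lemma zodd1 : zodd 1 = true.
Proof. by []. Qed.

Lemma zodd0 : zodd 0 = false.
Proof. by []. Qed.

Lemma ksign_zodd (R : pzRingType) (n : int) : ksign n = (-1) ^+ zodd n :> R.
Proof. by rewrite /ksign /zodd signr_odd. Qed.

Lemma eq_ksign (R : pzRingType) m n : zodd m = zodd n -> ksign m = ksign n :> R.
Proof. by rewrite !ksign_zodd => ->. Qed.

Lemma opp_ksign (R : pzRingType) n : - ksign n = ksign (n + 1) :> R.
Proof. by rewrite ksignD ksign1 mulrN1. Qed.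

Lemma ksign0 (R : pzRingType) : ksign 0 = 1 :> R.
Proof. by []. Qed.

End Parity.

Ltac ksign_merge :=
  repeat match goal with
  | |- context [ksign ?m * ksign ?n] => rewrite -(ksignD _ m n)
  | |- context [- ksign ?m] => rewrite (opp_ksign _ m)
  end.

Ltac zodd_split :=
  repeat match goal with
  | |- context [zodd (?m + ?n)] => rewrite (zoddD m n)
  | |- context [zodd (?m * ?n)] => rewrite (zoddM m n)
  | |- context [zodd (- ?m)] => rewrite (zoddN m)
  | |- context [zodd 1] => rewrite zodd1
  | |- context [zodd 0] => rewrite zodd0
  end;
  repeat match goal with |- context [zodd ?m] => case: (zodd m) end; by [].

Ltac ksolve :=
  ksign_merge;
  lazymatch goal with
  | |- ksign _ = ksign _ => apply: eq_ksign; zodd_split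
  | |- ksign _ = 1 => rewrite -[RHS](ksign0 _); apply: eq_ksign; zodd_split
  | |- 1 = ksign _ => rewrite -[LHS](ksign0 _); apply: eq_ksign; zodd_split
  end.

(** * Unbundled linear maps and homogeneous elements *)

Section LinearFun.
Variables (R : comNzRingType).

Lemma lin_funD (V W : lmodType R) (f : V -> W) x y :
  linear f -> f (x + y) = f x + f y.
Proof. by move=> fl; rewrite -[x]scale1r fl !scale1r. Qed.

Lemma lin_funZ (V W : lmodType R) (f : V -> W) c x :
  linear f -> f (c *: x) = c *: f x.
Proof. by move=> fl; rewrite -[c *: x]addr0 fl (lin_fun0 fl) addr0. Qed.

Lemma lin_funN (V W : lmodType R) (f : V -> W) x :
  linear f -> f (- x) = - f x.
Proof. by move=> fl; rewrite -scaleN1r lin_funZ // scaleN1r. Qed.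

Lemma lin_comp (U V W : lmodType R) (f : V -> W) (g : U -> V) :
  linear f -> linear g -> linear (fun x => f (g x)).
Proof. by move=> fl gl c x y; rewrite gl fl. Qed.

Lemma lin_scale (U V : lmodType R) (f : U -> V) (c : R) :
  linear f -> linear (fun x => c *: f x).
Proof. by move=> fl d x y; rewrite fl scalerDr !scalerA mulrC. Qed.

Lemma lin_add (U V : lmodType R) (f g : U -> V) :
  linear f -> linear g -> linear (fun x => f x + g x).
Proof. by move=> fl gl d x y; rewrite fl gl scalerDr addrACA. Qed.

Lemma lin_sum (U V : lmodType R) (I : Type) (r : seq I) (P : pred I)
    (f : U -> V) (F : I -> U) : linear f ->
  f (\sum_(i <- r | P i) F i) = \sum_(i <- r | P i) f (F i).
Proof.
move=> fl; apply: (big_morph f) => [x y|]; first exact: lin_funD.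
exact: lin_fun0.
Qed.

Lemma homog0 (V : lmodType R) (G : grading V) n : homog G n 0.
Proof. by rewrite /homog raddf0. Qed.

Lemma homogP (V : lmodType R) (G : grading V) n c x y :
  homog G n x -> homog G n y -> homog G n (c *: x + y).
Proof. by rewrite /homog linearP => /eqP-> /eqP->. Qed.

Lemma homogD (V : lmodType R) (G : grading V) n x y :
  homog G n x -> homog G n y -> homog G n (x + y).
Proof. by move=> hx hy; rewrite -[x]scale1r homogP. Qed.

Lemma homogZ (V : lmodType R) (G : grading V) n c x :
  homog G n x -> homog G n (c *: x).
Proof. by move=> hx; rewrite -[_ *: _]addr0 homogP // homog0. Qed.

Lemma gproj_lin (V : lmodType R) (G : grading V) n : linear (gproj G n).
Proof. by move=> c x y; rewrite linearP. Qed.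

Lemma homog_ext (V W : lmodType R) (G : grading V) (f g : V -> W) :
    linear f -> linear g -> (forall n x, homog G n x -> f x = g x) ->
  forall x, f x = g x.
Proof.
move=> fl gl fg x; have [s _ ->] := gproj_sum G x.
by rewrite !lin_sum //; apply: eq_bigr => n _; apply/fg/homog_gproj.
Qed.

End LinearFun.

(** * Unshuffles and the diagonal *)

Section Unshuffles.
Variables (R : comNzRingType) (V : lmodType R) (G : grading V).
Local Notation word := (seq (letter G)).
Local Notation S := (Sym G).

(* The signed sum of [F u v] over the unshuffles of [w] into [u] and [v]: the
   value on [w] of the diagonal, tested against an arbitrary function [F]. *)
Fixpoint unsh (N : lmodType R) (w : word) (F : word -> word -> N) : N :=
  if w is a :: w' then
    unsh w' (fun u v => F (a :: u) v + ksign (ldeg a * wdeg u) *: F u (a :: v))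
  else F [::] [::].

Lemma wdeg_nil : wdeg ([::] : word) = 0.
Proof. by rewrite /wdeg big_nil. Qed.

Lemma ldeg_mk n x : ldeg (mkletter G n x) = n.
Proof. by []. Qed.

Lemma lval_mk n x : homog G n x -> lval (mkletter G n x) = x.
Proof. by move/eqP. Qed.

Lemma mkletter_val (a : letter G) : mkletter G (ldeg a) (lval a) = a.
Proof. by case: a => [[n x] hx]; apply: val_inj; rewrite /= (eqP hx). Qed.

Section Target.
Variable N : lmodType R.
Implicit Types F : word -> word -> N.

(** The hypotheses supplied for [u] and [v] matter later: the degree equation closes sign
    computations, the length equation closes arguments by weight. *)
Lemma eq_unsh w F F' :
    (forall u v, wdeg u + wdeg v = wdeg w -> (size u + size v = size w)%N ->
      F u v = F' u v) ->
  unsh w F = unsh w F'.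
Proof.
elim: w F F' => [|a w ih] F F' h /=; first by apply: h; rewrite ?wdeg_nil ?addr0.
apply: ih => u v duv suv; congr (_ + _ *: _); apply: h; rewrite ?wdeg_cons /=.
- by rewrite -addrA duv.
- by rewrite addSn suv.
- by rewrite addrCA duv.
- by rewrite addnS suv.
Qed.

Lemma unsh_cons a w F : unsh (a :: w) F =
  unsh w (fun u v => F (a :: u) v + ksign (ldeg a * wdeg u) *: F u (a :: v)).
Proof. by []. Qed.

Lemma unshD w F F' :
  unsh w (fun u v => F u v + F' u v) = unsh w F + unsh w F'.
Proof.
elim: w F F' => [//|a w ih] F F' /=; rewrite -ih.
by apply: eq_unsh => u v _ _; rewrite scalerDr addrACA.
Qed.

Lemma unshZ w c F : unsh w (fun u v => c *: F u v) = c *: unsh w F.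
Proof.
elim: w F => [//|a w ih] F /=; rewrite -ih.
by apply: eq_unsh => u v _ _; rewrite scalerDr !scalerA mulrC.
Qed.

Lemma unsh0 w F :
    (forall u v, wdeg u + wdeg v = wdeg w -> (size u + size v = size w)%N ->
      F u v = 0) ->
  unsh w F = 0.
Proof.
move=> h; rewrite (eq_unsh (F' := fun u v => 0 *: (F u v))) ?unshZ ?scale0r //.
by move=> u v d s; rewrite h // scaler0.
Qed.

(** Counitality: only the unshuffle with empty left part survives, and its sign is 1. *)
Lemma unsh_nill w (F : word -> N) :
  unsh w (fun u v => if nilp u then F v else 0) = F w.
Proof.
elim: w F => [//|a w ih] F /=; rewrite -(ih (fun v => F (a :: v))).
apply: eq_unsh => -[|b u] v _ _ /=; last by rewrite scaler0 addr0.
by rewrite wdeg_nil mulr0 scale1r add0r.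
Qed.

Lemma unsh_nilr w (F : word -> N) :
  unsh w (fun u v => if nilp v then F u else 0) = F w.
Proof.
elim: w F => [//|a w ih] F /=; rewrite -(ih (fun v => F (a :: v))).
by apply: eq_unsh => u v _ _ /=; rewrite scaler0 addr0.
Qed.

(** Graded cocommutativity: exchanging the two parts permutes the unshuffles, and the Koszul signs
    differ by that of moving [u] past [v]. *)
Lemma unsh_comm w F :
  unsh w F = unsh w (fun u v => ksign (wdeg u * wdeg v) *: F v u).
Proof.
elim: w F => [|a w ih] F /=; first by rewrite wdeg_nil scale1r.
rewrite ih; apply: eq_unsh => u v _ _.
rewrite !wdeg_cons addrC scalerDr !scalerA; congr (_ *: _ + _ *: _); ksolve.
Qed.

(** Coassociativity: both sides distribute the letters of [w] over three words; in the induction the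
    first letter enters one of the three. *)
Lemma unsh_assoc w (F : word -> word -> word -> N) :
  unsh w (fun u v => unsh v (F u)) =
  unsh w (fun u v => unsh u (fun u1 u2 => F u1 u2 v)).
Proof.
elim: w F => [//|a w ih] F /=; rewrite !unshD ih.
under [in RHS]eq_unsh => u v _ _ do rewrite unshD.
rewrite unshD -addrA; congr (_ + _).
transitivity (unsh w (fun u v => unsh v (fun v1 v2 =>
  ksign (ldeg a * wdeg u) *: F u (a :: v1) v2 +
  ksign (ldeg a * wdeg u) *: (ksign (ldeg a * wdeg v1) *: F u v1 (a :: v2))))).
  apply: eq_unsh => u v _ _; rewrite -unshZ; apply: eq_unsh => v1 v2 _ _.
  by rewrite scalerDr.
rewrite (ih (fun u v1 v2 => _ + _)) -unshD; apply: eq_unsh => u v _ _.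
rewrite -unshZ -unshD. apply: eq_unsh => u1 u2 du _.
by congr (_ + _); rewrite scalerA -ksignD -du mulrDr.
Qed.

(** Cocommutativity in the first two of three parts. It brings to the right place an operator that
    acts on the second factor of a product. *)
Lemma unsh_swap w (F : word -> word -> word -> N) :
  unsh w (fun u v => unsh v (F u)) =
  unsh w (fun u v => unsh v (fun v1 v2 => ksign (wdeg u * wdeg v1) *: F v1 u v2)).
Proof.
rewrite unsh_assoc [RHS](unsh_assoc w (fun u v1 v2 => _ *: _)).
by apply: eq_unsh => u v _ _; rewrite unsh_comm.
Qed.

End Target.

Lemma unsh_lin (N P : lmodType R) (f : N -> P) w F :
  linear f -> f (unsh w F) = unsh w (fun u v => f (F u v)).
Proof.
move=> fl; elim: w F => [//|a w ih] F /=; rewrite ih.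
by apply: eq_unsh => u v _ _; rewrite lin_funD // lin_funZ.
Qed.

Lemma sdiag_sw w : sdiag (sw w) = unsh w (fun u v => tens (sw u) (sw v)).
Proof.
elim: w => [|a w ih] /=; first exact: sdiag_nil.
rewrite sdiag_cons ih (unsh_lin _ _ (@diag_step_is_linear _ _ _ a)).
by apply: eq_unsh => u v _ _; rewrite diag_step_sw.
Qed.

Definition bilinear_family (N : lmodType R) (B : int -> int -> S -> S -> N) :=
  (forall m n y, linear (B m n ^~ y)) /\ (forall m n x, linear (B m n x)).

Lemma conv_linear (N : lmodType R) (B : int -> int -> S -> S -> N) :
  bilinear_family B -> linear (conv B).
Proof.
by move=> [Bl Br]; apply: (lin_comp (htlift_linear _ _ Bl Br));
  exact: sdiag_is_linear.
Qed.

Lemma conv_sw (N : lmodType R) (B : int -> int -> S -> S -> N) w :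
    bilinear_family B ->
  conv B (sw w) = unsh w (fun u v => B (wdeg u) (wdeg v) (sw u) (sw v)).
Proof.
move=> [Bl Br]; rewrite /conv sdiag_sw (unsh_lin _ _ (htlift_linear _ _ Bl Br)).
by apply: eq_unsh => u v _ _; rewrite (htlift_tens _ _ (homog_sw u) (homog_sw v)).
Qed.

(** A homogeneous [x] equals [sproj n x], and [sproj n] kills the words of other degrees. *)
Lemma homog_sym_ext (N : lmodType R) (f g : S -> N) n : linear f -> linear g ->
    (forall w, wdeg w = n -> f (sw w) = g (sw w)) ->
  forall x, homog (sgrading G) n x -> f x = g x.
Proof.
move=> fl gl fg x /eqP <-; rewrite -/(sproj n x).
apply: (@linear_sym_ext _ _ _ _ (fun x => f (sproj n x)) (fun x => g (sproj n x))).
- by apply: (lin_comp fl); exact: sproj_is_linear.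
- by apply: (lin_comp gl); exact: sproj_is_linear.
- by move=> w; rewrite sproj_sw; case: eqP => [/fg//|_]; rewrite (lin_fun0 fl) (lin_fun0 gl).
Qed.

Lemma degree_sw (N : lmodType R) (H : grading N) (f : S -> N) k : linear f ->
    (forall w, homog H (wdeg w + k) (f (sw w))) ->
  degree_map (sgrading G) H k f.
Proof.
move=> fl h n x hx; apply/eqP; move: x hx.
apply: homog_sym_ext => //; first by exact: (lin_comp (@gproj_lin _ _ _ _)).
by move=> w <-; exact: eqP (h w).
Qed.

Lemma sw_move u a v :
  sw (u ++ a :: v) = ksign (wdeg u * ldeg a) *: sw (a :: u ++ v) :> S.
Proof.
elim: u => [|b u ih] /=; first by rewrite wdeg_nil mul0r scale1r.
rewrite -lmul_sw ih (lin_funZ _ _ (@lmul_is_linear _ _ _ b)) lmul_sw.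
rewrite (sw_comm [::] (u ++ v) b a) scalerA wdeg_cons /=.
by congr (_ *: _); ksolve.
Qed.

Lemma sw_rcons w a :
  sw (rcons w a) = ksign (wdeg w * ldeg a) *: sw (a :: w) :> S.
Proof. by rewrite -cats1 sw_move cats0. Qed.

(** Written as a function of the vector [x], left multiplication is linear in [x]; a word with
    [mkletter] inside does not display this. *)
Definition lcons n (x : V) : S -> S := lmul (mkletter G n x).

Lemma lconsl n y : linear (fun x => lcons n x y).
Proof.
move=> c x x'; move: y; apply: linear_sym_ext => [||w]; first exact: lmul_is_linear.
- apply: lin_add; last exact: lmul_is_linear.
  by apply: lin_scale; exact: lmul_is_linear.
- by rewrite /lcons !lmul_sw (sw_lin [::]).
Qed.

Lemma lconsr n x : linear (lcons n x).
Proof. exact: lmul_is_linear. Qed.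

Lemma lcons_sw n x w : lcons n x (sw w) = sw (mkletter G n x :: w).
Proof. exact: lmul_sw. Qed.

(** * Coderivations and their corestrictions *)

Section Coderivations.

(** The degree is a parameter because the square of a coderivation of degree -1, of degree -2, is
    treated by the same uniqueness argument. *)
Definition coder_deg (k : int) (g : S -> S) : Prop :=
  [/\ linear g, degree_map (sgrading G) (sgrading G) k g &
      forall w, sdiag (g (sw w)) = unsh w (fun u v =>
        tens (g (sw u)) (sw v) + ksign (k * wdeg u) *: tens (sw u) (g (sw v)))].

Lemma conv_coder k g (N : lmodType R) (B : int -> int -> S -> S -> N) w :
    coder_deg k g -> bilinear_family B ->
  conv B (g (sw w)) = unsh w (fun u v =>
    B (wdeg u + k) (wdeg v) (g (sw u)) (sw v) +
    ksign (k * wdeg u) *: B (wdeg u) (wdeg v + k) (sw u) (g (sw v))).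
Proof.
move=> [gl gd gc] [Bl Br]; have hl := htlift_linear (sgrading G) (sgrading G) Bl Br.
rewrite /conv gc (unsh_lin _ _ hl); apply: eq_unsh => u v _ _.
have hu := homog_sw u; have hv := homog_sw v.
rewrite (lin_funD _ _ hl) (lin_funZ _ _ hl).
by rewrite (htlift_tens _ _ (gd _ _ hu) hv) // (htlift_tens _ _ hu (gd _ _ hv)).
Qed.

Definition corest_deg (h : S -> V) : Prop :=
  linear h /\ degree_map (sgrading G) G (-1) h.

Variable h : S -> V.
Hypothesis hh : corest_deg h.

Let hl : linear h. Proof. exact: hh.1. Qed.

Lemma coder_of_bil : bilinear_family
  (fun m (_ : int) x' x'' => lmul (mkletter G (m - 1) (h x')) x'' : S).
Proof.
split=> m _ x; last exact: lmul_is_linear.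
by apply: (lin_comp (lconsl (m - 1) x)).
Qed.

Lemma coder_of_linear : linear (coder_of h).
Proof. exact: conv_linear coder_of_bil. Qed.

Lemma coder_of_sw w : coder_of h (sw w) =
  unsh w (fun u v => sw (mkletter G (wdeg u - 1) (h (sw u)) :: v)).
Proof.
rewrite /coder_of conv_sw; last exact: coder_of_bil.
by apply: eq_unsh => u v _ _; rewrite lmul_sw.
Qed.

(** Each term of [coder_of h] is a letter followed by [v], so the projection to words of length one
    keeps only [v = [::]]. *)
Lemma corest_coder_of x : corest (coder_of h x) = h x.
Proof.
move: x; apply: linear_sym_ext => [|//|w].
  by apply: (lin_comp (@corest_is_linear _ _ _)); exact: coder_of_linear.
rewrite coder_of_sw (unsh_lin _ _ (@corest_is_linear _ _ _)).
rewrite -[RHS](unsh_nilr w (fun u => h (sw u))).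
apply: eq_unsh => u [|b v] _ _; rewrite corest_sw //.
by rewrite lval_mk // (hh.2 _ _ (homog_sw u)).
Qed.

Lemma homog_unsh (N : lmodType R) (H : grading N) n w F :
    (forall u v, wdeg u + wdeg v = wdeg w -> homog H n (F u v)) ->
  homog H n (unsh w F).
Proof.
move=> hF; apply/eqP; rewrite (unsh_lin _ _ (@gproj_lin _ _ H n)).
by apply: eq_unsh => u v d _; exact/eqP/hF.
Qed.

(** In the diagonal of the product of [h u] and [v] the new letter goes left or right. The left
    terms are collected by coassociativity, the right ones by exchanging [u] with the part before
    it. *)
Lemma coder_ofP : coder_deg (-1) (coder_of h).
Proof.
split=> [||w]; first exact: coder_of_linear.
  apply: degree_sw => [|w]; first exact: coder_of_linear.
  rewrite coder_of_sw; apply: homog_unsh => u v <-.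
  by rewrite addrAC -[X in X + _](ldeg_mk (wdeg u - 1) (h (sw u))) -wdeg_cons
    homog_sw.
pose K u := mkletter G (wdeg u - 1) (h (sw u)).
rewrite coder_of_sw (unsh_lin _ _ (@sdiag_is_linear _ _ _)).
transitivity (unsh w (fun u v => unsh v (fun v1 v2 =>
    tens (sw (K u :: v1) : S) (sw v2 : S))) +
  unsh w (fun u v => unsh v (fun v1 v2 => ksign ((wdeg u - 1) * wdeg v1) *:
    tens (sw v1 : S) (sw (K u :: v2) : S)))).
  rewrite -unshD; apply: eq_unsh => u v _ _; rewrite -unshD sdiag_sw /=.
  by apply: eq_unsh => v1 v2 _ _; rewrite ldeg_mk.
rewrite unshD; congr (_ + _).
  rewrite (unsh_assoc w (fun u v1 v2 => tens _ _)).
  apply: eq_unsh => u v _ _; rewrite coder_of_sw.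
  by rewrite (unsh_lin _ _ (@tens_linl _ _ _ (sw v : S))).
rewrite (unsh_swap w (fun u v1 v2 => _ *: _)).
apply: eq_unsh => u v _ _; rewrite coder_of_sw.
rewrite (unsh_lin _ _ (@tens_linr _ _ _ (sw u : S))) -unshZ.
by apply: eq_unsh => v1 v2 _ _; rewrite scalerA; congr (_ *: _); ksolve.
Qed.

End Coderivations.
End Unshuffles.

(** * Word length and the coaugmentation filtration *)

Section WordLength.
Variables (R : comNzRingType) (V : lmodType R) (G : grading V).
Local Notation S := (Sym G).

Lemma coaug_sw l (w : seq (letter G)) : (size w < l)%N -> coaug l (sw w).
Proof.
move=> lw; rewrite /coaug (bigD1 (Ordinal lw)) //= wproj_sw eqxx.
rewrite big1 ?addr0 // => i /eqP il; rewrite wproj_sw; case: eqP => // e.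
by case: il; apply: val_inj.
Qed.

Lemma linear_coaug_ext (N : lmodType R) (f g : S -> N) l : linear f -> linear g ->
    (forall w, (size w < l)%N -> f (sw w) = g (sw w)) ->
  forall x, coaug l x -> f x = g x.
Proof.
move=> fl gl fg x <-; rewrite !lin_sum //; apply: eq_bigr => i _.
move: x; apply: linear_sym_ext => [||w].
- by apply: (lin_comp fl); exact: wproj_is_linear.
- by apply: (lin_comp gl); exact: wproj_is_linear.
- by rewrite wproj_sw; case: eqP => [e|_];
    [rewrite fg // e|rewrite (lin_fun0 fl) (lin_fun0 gl)].
Qed.

(** Every element is a finite combination of words, hence the sum of its components below some
    length [l]. *)
Lemma wproj_eq0 (x : S) : (forall i, wproj i x = 0) -> x = 0.
Proof.
suff [l hl] : exists l, forall m, (l <= m)%N -> coaug m x.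
  by move=> h; rewrite -(hl l) // big1.
elim/pres_ind: x => [|c w x [l hl]].
  exists 0%N => m _; rewrite /coaug big1 // => i _.
  exact: lin_fun0 (wproj_is_linear _).
exists (maxn l (size w).+1) => m; rewrite geq_max => /andP[lm wm].
rewrite /coaug; under eq_bigr => i _ do rewrite wproj_is_linear.
rewrite big_split -scaler_sumr (hl m lm) -/(sw w).
by have /= := coaug_sw wm; rewrite /coaug => ->.
Qed.

End WordLength.

(** * Coderivations are determined by their corestriction *)

Section CofreeUniqueness.
Variables (R : comNzRingType) (iota : {rmorphism rat -> R}).
Variables (V : lmodType R) (G : grading V).
Local Notation S := (Sym G).

(** The rationals in [R] make multiplication by a positive integer injective on every module;
    uniqueness of coderivations rests on this. *)
Lemma natr_scale_eq0 (N : lmodType R) n (x : N) :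
  (0 < n)%N -> n%:R *: x = 0 -> x = 0.
Proof.
move=> n0 nx; rewrite -[x]scale1r -(rmorph1 iota).
have <- : n%:R^-1 * n%:R = 1 :> rat.
  by rewrite mulVf // Num.Theory.pnatr_eq0 -lt0n.
by rewrite rmorphM rmorph_nat -scalerA nx scaler0.
Qed.

(** [conv euler] is the Euler operator: the diagonal, then the projection to [V] on the left factor,
    then multiplication. *)
Definition euler (m _ : int) (x y : S) : S := lcons m (corest x) y.

Lemma euler_bil : bilinear_family euler.
Proof.
split=> m n x; last exact: lconsr.
by apply: (lin_comp (lconsl m x)); exact: corest_is_linear.
Qed.

(** Only unshuffles with a one-letter left part contribute; each moves a letter of [w] to the front
    with the Koszul sign of that move, so each gives back [w]. *)
Lemma conv_euler_sw w : conv euler (sw w) = (size w)%:R *: sw w.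
Proof.
rewrite conv_sw; last exact: euler_bil.
elim: w => [|a w ih] /=.
  rewrite /euler scale0r corest_sw.
  exact: (lin_fun0 (lconsl _ _)).
rewrite unshD mulrS scalerDl scale1r; congr (_ + _).
  rewrite -[RHS](unsh_nill w (fun v => sw (a :: v) : S)).
  apply: eq_unsh => -[|b u] v _ _ /=; rewrite /euler corest_sw /=; last first.
    exact: (lin_fun0 (lconsl _ _)).
  by rewrite lcons_sw wdeg_cons wdeg_nil addr0 mkletter_val.
rewrite -lmul_sw -(lin_funZ _ _ (@lmul_is_linear _ _ _ a)) -ih.
rewrite (unsh_lin _ _ (@lmul_is_linear _ _ _ a)); apply: eq_unsh => u v _ _.
rewrite /euler corest_sw; case: u => [|b [|b' u]] /=;
  do ?by rewrite !(lin_fun0 (lconsl _ _)) scaler0 (lin_fun0 (@lmul_is_linear _ _ _ a)).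
rewrite !lcons_sw lmul_sw (sw_comm [::] v a) wdeg_cons wdeg_nil addr0.
by rewrite mkletter_val.
Qed.

Lemma wproj_conv_euler i x : wproj i (conv euler x) = i%:R *: wproj i x.
Proof.
move: x; apply: linear_sym_ext => [||w].
- by apply: (lin_comp (@wproj_is_linear _ _ _ _)); exact: conv_linear euler_bil.
- by apply: lin_scale; exact: wproj_is_linear.
rewrite conv_euler_sw (lin_funZ _ _ (@wproj_is_linear _ _ _ _)) wproj_sw.
by case: eqP => [->//|_]; rewrite !scaler0.
Qed.

(** The counit axiom in the form of a convolution, so that the co-Leibniz rule [conv_coder] can be
    played against it. *)
Definition counit_act (_ _ : int) (x y : S) : S := (counit x : R) *: y.

Lemma counit_is_linear : linear (@counit R V G).
Proof. exact: plift_is_linear (@counit_compat _ _ _). Qed.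

Lemma counit_act_bil : bilinear_family counit_act.
Proof.
split=> m n x c y z; rewrite /counit_act.
  by rewrite counit_is_linear scalerDl scalerA.
by rewrite scalerDr !scalerA mulrC.
Qed.

Lemma conv_counit_act x : conv counit_act x = x.
Proof.
move: x; apply: linear_sym_ext => [|//|w]; first exact: conv_linear counit_act_bil.
rewrite conv_sw; last exact: counit_act_bil.
rewrite -[RHS](unsh_nill w (fun v => sw v : S)); apply: eq_unsh => u v _ _.
by rewrite /counit_act counit_sw; case: nilp; rewrite ?scale1r ?scale0r.
Qed.

Lemma wproj0 (x : S) : wproj 0 x = (counit x : R) *: sw [::].
Proof.
move: x; apply: linear_sym_ext => [||w]; first exact: wproj_is_linear.
  by move=> c x y; rewrite counit_is_linear scalerDl scalerA.
by rewrite wproj_sw counit_sw; case: w => [|a w]; rewrite ?scale1r ?scale0r.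
Qed.

(* On [S^n] the operator [conv euler] is multiplication by [n]; applied to the
   value of a coderivation it only involves shorter words and corestrictions. *)
Lemma coder_eq0 k (g : S -> S) : coder_deg k g ->
  (forall w, corest (g (sw w)) = 0) -> forall x, g x = 0.
Proof.
move=> gk g0; have [gl _ _] := gk.
apply: linear_sym_ext => // [c x y|w]; first by rewrite scaler0 addr0.
have [n] := ubnP (size w); elim: n w => // n ih w wn.
have {}ih v : (size v < size w)%N -> g (sw v) = 0.
  by move=> vw; apply: ih; rewrite (leq_trans vw).
(* The component of length zero is invisible to [euler]. The counit axiom at [g w], expanded by the
   co-Leibniz rule and induction, reads [g w = counit (g w) 1 + g w]. *)
have c0 : (counit (g (sw w)) : R) *: sw [::] = 0 :> S.
  have := conv_counit_act (g (sw w)); rewrite (conv_coder _ gk counit_act_bil).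
  rewrite unshD => h; rewrite -[RHS](subrr (g (sw w))) -[X in X - _]h.
  apply/eqP; rewrite eq_sym subr_eq eq_sym; apply/eqP; congr (_ + _).
    rewrite -[LHS](unsh_nilr w (fun u => (counit (g (sw u)) : R) *: sw [::] : S)).
    apply: eq_unsh => u [|b v] _ /= s //; rewrite /counit_act ih; last lia.
    by rewrite (lin_fun0 counit_is_linear) scale0r.
  rewrite -[LHS](unsh_nill w (fun u => g (sw u))).
  apply: eq_unsh => -[|b u] v _ /= s; rewrite /counit_act counit_sw.
    by rewrite wdeg_nil mulr0 !scale1r.
  by rewrite scale0r scaler0.
(* The terms with [corest (g u)] vanish by hypothesis; in the others [u] is a single letter, so [v]
   is shorter than [w] and induction gives [g v = 0]. *)
have e0 : conv euler (g (sw w)) = 0.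
  rewrite (conv_coder _ gk euler_bil); apply: unsh0 => u v _ s.
  rewrite /euler g0 (lin_fun0 (lconsl _ _)) add0r corest_sw.
  case: u s => [|b [|b' u]] /= s; rewrite ?(lin_fun0 (lconsl _ _)) ?scaler0 //.
  by rewrite ih ?(lin_fun0 (lconsr _ _)) ?scaler0 //; lia.
apply: wproj_eq0 => -[|i]; first by rewrite wproj0.
apply: (@natr_scale_eq0 _ i.+1) => //.
by rewrite -wproj_conv_euler e0 (lin_fun0 (@wproj_is_linear _ _ _ _)).
Qed.

Lemma coder_degB k (g g' : S -> S) : coder_deg k g -> coder_deg k g' ->
  coder_deg k (fun x => g x - g' x).
Proof.
move=> [gl gd gc] [gl' gd' gc']; have gl'' : linear (fun x => g x - g' x).
  by move=> c x y; rewrite gl gl' opprD addrACA scalerBr.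
split=> [//||w].
  move=> n x hx; have := homogP (-1) (gd' _ _ hx) (gd _ _ hx).
  by rewrite scaleN1r [X in homog _ _ X]addrC.
have sl := @sdiag_is_linear _ _ G.
rewrite (lin_funD _ _ sl) (lin_funN _ sl) gc gc' -scaleN1r -unshZ -unshD.
apply: eq_unsh => u v _ _.
rewrite (lin_funD _ _ (tens_linl _)) (lin_funN _ (tens_linl _)).
rewrite (lin_funD _ _ (tens_linr _)) (lin_funN _ (tens_linr _)).
by rewrite scaleN1r scalerDr opprD scalerN addrACA.
Qed.

Lemma coder_bil k (g : S -> S) : linear g -> bilinear_family
  (fun m _ x y => tens (g x) y + ksign (k * m) *: tens x (g y)).
Proof.
move=> gl; split=> m n x; apply: lin_add.
- exact: (lin_comp (tens_linl x)).
- by apply: lin_scale; exact: tens_linl.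
- exact: tens_linr.
- by apply: lin_scale; exact: (lin_comp (tens_linr x)).
Qed.

Lemma sdiag_coder k (g : S -> S) x : coder_deg k g ->
  sdiag (g x) =
    conv (fun m _ x y => tens (g x) y + ksign (k * m) *: tens x (g y)) x.
Proof.
move=> [gl _ gc]; move: x; apply: linear_sym_ext => [||w].
- by apply: (lin_comp _ gl); exact: sdiag_is_linear.
- exact: conv_linear (coder_bil _ gl).
- by rewrite gc conv_sw //; exact: coder_bil.
Qed.

(** The mixed terms, with [g] on both tensor factors, occur twice with opposite signs because [g] is
    odd. *)
Lemma coder_deg_sq (g : S -> S) : coder_deg (-1) g ->
  coder_deg (-1 - 1) (fun x => g (g x)).
Proof.
move=> gk; have [gl gd gc] := gk; split; first exact: (lin_comp gl gl).
  by move=> n x hx; rewrite addrA; apply/gd/gd.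
move=> w; rewrite (sdiag_coder _ gk) (conv_coder _ gk (coder_bil _ gl)).
apply: eq_unsh => u v _ _; rewrite scalerDr !scalerA -!addrA; congr (_ + _).
rewrite addrA -scalerDl.
have -> : ksign (-1 * (wdeg u - 1)) + ksign (-1 * wdeg u) = 0 :> R.
  apply/eqP; rewrite addr_eq0; apply/eqP; ksolve.
rewrite scale0r add0r; congr (_ *: _); ksolve.
Qed.

Lemma is_coder_deg (g : S -> S) : is_coder g -> coder_deg (-1) g.
Proof.
move=> [gl gd gc]; split=> // w; rewrite gc.
have e : (fun (m _ : int) x y => tens (g x) y + ksign m *: tens x (g y)) =
    (fun m _ x y => tens (g x) y + ksign (- 1 * m) *: tens x (g y)).
  apply/funext => m; apply/funext => _; apply/funext => x; apply/funext => y.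
  by congr (_ + _ *: _); ksolve.
by rewrite e conv_sw //; exact: coder_bil.
Qed.

Lemma coder_ofD (h h' : S -> V) x : corest_deg h -> corest_deg h' ->
  coder_of (fun x => h x + h' x) x = coder_of h x + coder_of h' x.
Proof.
move=> hh hh'; have hh'' : corest_deg (fun x => h x + h' x).
  split; first by apply: lin_add; [exact: hh.1|exact: hh'.1].
  by move=> n y hy; apply: homogD; [exact: hh.2|exact: hh'.2].
move: x; apply: linear_sym_ext => [||w]; first exact: coder_of_linear.
  by apply: lin_add; exact: coder_of_linear.
rewrite !coder_of_sw // -unshD; apply: eq_unsh => u v _ _.
by rewrite -!lcons_sw (lin_funD _ _ (lconsl _ _)).
Qed.

Lemma coder_ofE (g : S -> S) x : coder_deg (-1) g ->
    corest_deg (fun x => corest (g x)) ->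
  g x = coder_of (fun x => corest (g x)) x.
Proof.
move=> gk hg; apply/eqP; rewrite -subr_eq0; apply/eqP.
move: x; apply: (coder_eq0 (coder_degB gk (coder_ofP hg))) => w.
have cl := @corest_is_linear _ _ G.
by rewrite (lin_funD _ _ cl) (lin_funN _ cl) corest_coder_of // subrr.
Qed.

Lemma corest_homog : degree_map (sgrading G) G 0 (@corest R V G).
Proof.
apply: degree_sw => [|w]; first exact: corest_is_linear.
rewrite corest_sw addr0; case: w => [|a [|b w]]; rewrite ?homog0 //.
by rewrite wdeg_cons wdeg_nil addr0 lvalP.
Qed.

Lemma corest_coder_deg (g : S -> S) : coder_deg (-1) g ->
  corest_deg (fun x => corest (g x)).
Proof.
move=> [gl gd _]; split; first exact: (lin_comp (@corest_is_linear _ _ _) gl).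
by move=> n x hx; rewrite -[_ - 1]addr0; apply/corest_homog/gd.
Qed.

Lemma wproj_homog k : degree_map (sgrading G) (sgrading G) 0 (@wproj R V G k).
Proof.
apply: degree_sw => [|w]; first exact: wproj_is_linear.
by rewrite wproj_sw addr0; case: ifP; rewrite ?homog0 ?homog_sw.
Qed.

Lemma constituent_deg (g : S -> S) j : coder_deg (-1) g ->
  corest_deg (constituent g j).
Proof.
move=> gk; have [hl hd] := corest_coder_deg gk.
split; first exact: (lin_comp hl (@wproj_is_linear _ _ _ _)).
by move=> n x hx; apply: hd; rewrite -[n]addr0; apply: wproj_homog.
Qed.

Lemma constituent_sw (g : S -> S) j w : linear g ->
  constituent g j (sw w) = if size w == j.+1 then corest (g (sw w)) else 0.
Proof.
move=> gl; rewrite /constituent wproj_sw; case: ifP => // _.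
by rewrite (lin_fun0 gl) (lin_fun0 (@corest_is_linear _ _ _)).
Qed.

(* A coderivation lowering the coaugmentation filtration maps [S^1] to [S^0],
   where the corestriction vanishes. *)
Lemma corest_filtered (g : S -> S) w : is_filtered_coder g ->
  (size w <= 1)%N -> corest (g (sw w)) = 0.
Proof.
move=> [_ gf] w1; have : coaug 1 (g (sw w)) by apply/gf/coaug_sw.
rewrite /coaug big_ord1 => <-; rewrite wproj0.
have cl := @corest_is_linear _ _ G.
by rewrite (lin_funZ _ _ cl) corest_sw scaler0.
Qed.

End CofreeUniqueness.

Section AlgebraLinear.
Variables (R : comNzRingType) (A : algType R).

Lemma lin_mull (U : lmodType R) (f : U -> A) b :
  linear f -> linear (fun x => f x * b).
Proof. by move=> fl c x y; rewrite fl mulrDl scalerAl. Qed.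

Lemma lin_mulr (U : lmodType R) (f : U -> A) b :
  linear f -> linear (fun x => b * f x).
Proof. by move=> fl c x y; rewrite fl mulrDr scalerAr. Qed.

Lemma unsh_mull (V : lmodType R) (G : grading V) w
    (F : seq (letter G) -> seq (letter G) -> A) b :
  unsh w F * b = unsh w (fun u v => F u v * b).
Proof. exact: (unsh_lin w F (lin_mull b (f := id) _)). Qed.

Lemma unsh_mulr (V : lmodType R) (G : grading V) w
    (F : seq (letter G) -> seq (letter G) -> A) b :
  b * unsh w F = unsh w (fun u v => b * F u v).
Proof. exact: (unsh_lin w F (lin_mulr b (f := id) _)). Qed.

End AlgebraLinear.

(** * The operator of a cochain and a coderivation *)

Section Operators.
Variables (R : comNzRingType) (A : cdga R) (L : dgModule A).
Local Notation sL := (susp L).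
Local Notation grA := (cdga_gr A).
Local Notation grL := (dgm_gr sL).
Local Notation act := (@dgm_act R A sL).
Local Notation S := (Sym grL).
Local Notation grS := (sgrading grL).

Definition hom_form (p : int) (phi : S -> A) : Prop :=
  linear phi /\ degree_map grS grA p phi.

Lemma sym_form_hom p phi : sym_form p phi -> hom_form p phi.
Proof. by case. Qed.

Lemma is_derP k (f : A -> A) : is_der k f ->
  [/\ linear f, forall m a, homog grA m a -> homog grA (m + k) (f a) &
      forall m n a b, homog grA m a -> homog grA n b ->
        f (a * b) = f a * b + ksign (k * m) *: (a * f b)].
Proof. by move=> [fl [[fd _] fm]]. Qed.

Lemma is_der_d : is_der (-1) (cdga_d A).
Proof. by split; [exact: linearP|exact: cdga_der (cdgaP A)]. Qed.

Lemma is_der0 k : is_der k (0 : A -> A).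
Proof.
split; first by move=> c x y; rewrite /= scaler0 addr0.
split; first split.
- by move=> m a _; exact: homog0.
- by move=> m c x y _ _; rewrite scaler0 addr0.
- by move=> m n x y _ _; rewrite /= mul0r mulr0 scaler0 addr0.
Qed.

Definition der_cochain (tau : S -> A -> A) : Prop :=
  linear tau /\ forall w, is_der (wdeg w - 1) (tau (sw w)).

Lemma act_homog m n a x : homog grA m a -> homog grL n x ->
  homog grL (m + n) (act a x).
Proof. exact: dgm_act_deg. Qed.

Lemma act_linl x : linear (fun a => act a x).
Proof. exact: dgm_actl. Qed.

Lemma act_linr a : linear (act a).
Proof. exact: dgm_actr. Qed.

Lemma ldeg_lact m a (alpha : letter grL) : ldeg (lact m a alpha) = m + ldeg alpha.
Proof. by []. Qed.

Lemma lval_lact m a (alpha : letter grL) : homog grA m a ->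
  lval (lact m a alpha) = act a (lval alpha).
Proof. by move=> ha; rewrite lval_mk //; apply: act_homog (lvalP _). Qed.

(** Moving a letter to the front costs a Koszul sign, and this is the sign by which linearity in an
    inner slot differs from linearity in the first. *)
Lemma multilinearP (N : lmodType R) (actN : A -> N -> N) p (f : S -> N) :
    (forall a, linear (actN a)) -> linear f ->
  is_multilinear actN p f <->
  (forall m a alpha v, homog grA m a ->
    f (sw (lact m a alpha :: v)) = ksign (m * p) *: actN a (f (sw (alpha :: v)))).
Proof.
move=> nl fl; split=> h m a => [alpha v ha|u alpha v ha].
  by rewrite (h m a [::]) // wdeg_nil addr0.
rewrite !sw_move !(lin_funZ _ _ fl) h // (lin_funZ _ _ (nl a)) ldeg_lact !scalerA.
by congr (_ *: _); ksolve.
Qed.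

Section Tau.
Variable tau : S -> A -> A.
Hypothesis htau : der_cochain tau.

Lemma tau_linr x : linear (tau x).
Proof.
elim/pres_ind: x => [|c w x ih].
  by rewrite (lin_fun0 htau.1) => c x y; rewrite /= scaler0 addr0.
have [wl _ _] := is_derP (htau.2 w).
by rewrite (htau.1 c (pgen w) x); exact: (lin_add (lin_scale c wl) ih).
Qed.

Lemma tau_linl a : linear (fun x => tau x a).
Proof. by move=> c x y; rewrite htau.1. Qed.

Lemma tau_homog w m a : homog grA m a ->
  homog grA (m + (wdeg w - 1)) (tau (sw w) a).
Proof. by have [_ h _] := is_derP (htau.2 w); exact: h. Qed.

Lemma tau_mul w m n a b : homog grA m a -> homog grA n b ->
  tau (sw w) (a * b) =
    tau (sw w) a * b + ksign ((wdeg w - 1) * m) *: (a * tau (sw w) b).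
Proof. by have [_ _ h] := is_derP (htau.2 w); exact: h. Qed.

Lemma tau_bil p phi : linear phi -> bilinear_family
  (fun m (_ : int) x' x'' => ksign (p * m) *: tau x' (phi x'')).
Proof.
move=> phil; split=> m n x; apply: lin_scale; first exact: tau_linl.
exact: (lin_comp (tau_linr x) phil).
Qed.

Variable h : S -> sL.
Hypothesis hh : corest_deg h.

Definition coder_act (p : int) (phi : S -> A) (x : S) : A :=
  conv (fun m _ x' x'' => ksign (p * m) *: tau x' (phi x'')) x
  + ksign (p + 1) *: phi (coder_of h x).

Lemma coder_act_linear p phi : linear phi -> linear (coder_act p phi).
Proof.
move=> phil; apply: lin_add; first exact: conv_linear (tau_bil _ phil).
by apply: lin_scale; apply: (lin_comp phil); exact: coder_of_linear.
Qed.

Lemma coder_act_sw p phi w : linear phi -> coder_act p phi (sw w) =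
  unsh w (fun u v => ksign (p * wdeg u) *: tau (sw u) (phi (sw v)))
  + ksign (p + 1) *: phi (coder_of h (sw w)).
Proof. by move=> phil; rewrite /coder_act conv_sw //; exact: tau_bil. Qed.

Lemma coder_act_linp p c phi psi : linear phi -> linear psi ->
  coder_act p (c *: phi + psi) = c *: coder_act p phi + coder_act p psi.
Proof.
move=> phil psil; have cl : linear (c *: phi + psi).
  exact: (lin_add (lin_scale c phil) psil).
apply/funext; apply: linear_sym_ext.
- exact: coder_act_linear.
- by apply: (lin_add (lin_scale c _)); exact: coder_act_linear.
move=> w; rewrite -[RHS]/(c *: coder_act p phi _ + coder_act p psi _).
rewrite !coder_act_sw // [c *: (_ + _)]scalerDr [RHS]addrACA -unshZ -unshD; congr (_ + _).
  apply: eq_unsh => u v _ _.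
  rewrite -[(c *: phi + psi) _]/(c *: phi _ + psi _) tau_linr scalerDr.
  by rewrite !scalerA [c * _]mulrC.
by rewrite -[(c *: phi + psi) _]/(c *: phi _ + psi _) scalerDr !scalerA mulrC.
Qed.

Lemma coder_act_form p phi : hom_form p phi -> hom_form (p - 1) (coder_act p phi).
Proof.
move=> [phil phid]; split; first exact: coder_act_linear.
apply: degree_sw => [|w]; first exact: coder_act_linear.
rewrite coder_act_sw //; apply: homogD; last first.
  apply: homogZ; rewrite addrCA addrC; apply: phid.
  by have [_ hd _] := coder_ofP hh; apply/hd/homog_sw.
apply: homog_unsh => u v <-; apply: homogZ.
have -> : wdeg u + wdeg v + (p - 1) = wdeg v + p + (wdeg u - 1) by lia.
by apply/tau_homog/phid/homog_sw.
Qed.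

Lemma cup_bil q (phi psi : S -> A) : linear phi -> linear psi ->
  bilinear_family (fun m (_ : int) x' x'' => ksign (q * m) *: (phi x' * psi x'')).
Proof.
by move=> phil psil; split=> m n x; apply: lin_scale;
  [exact: lin_mull|exact: lin_mulr].
Qed.

Lemma cup_sw p q (phi psi : S -> A) w : linear phi -> linear psi ->
  cup p q phi psi (sw w) =
    unsh w (fun u v => ksign (q * wdeg u) *: (phi (sw u) * psi (sw v))).
Proof. by move=> phil psil; rewrite /cup conv_sw //; exact: cup_bil. Qed.

Lemma cup_linear p q (phi psi : S -> A) : linear phi -> linear psi ->
  linear (cup p q phi psi).
Proof. by move=> phil psil; exact: conv_linear (cup_bil q phil psil). Qed.

Lemma coder_act_cup p q phi psi : hom_form p phi -> hom_form q psi ->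
  coder_act (p + q) (cup p q phi psi) =
    cup (p - 1) q (coder_act p phi) psi
    + ksign (-1 * p) *: cup p (q - 1) phi (coder_act q psi).
Proof.
move=> [phil phid] [psil psid].
have dphil := coder_act_linear p phil; have dpsil := coder_act_linear q psil.
have cl := cup_linear p q phil psil.
apply/funext; apply: linear_sym_ext.
- exact: coder_act_linear.
- apply: lin_add; first exact: cup_linear.
  by apply: lin_scale; exact: cup_linear.
move=> w; rewrite -[RHS]/(cup _ _ _ _ _ + _ *: cup _ _ _ _ _) !cup_sw //.
rewrite coder_act_sw // {2}/cup (conv_coder _ (coder_ofP hh) (cup_bil q phil psil)).
transitivity (unsh w (fun u v => unsh v (fun v1 v2 =>
      ksign ((p + q) * wdeg u + q * wdeg v1) *:
        (tau (sw u) (phi (sw v1)) * psi (sw v2)))) +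
    unsh w (fun u v => unsh v (fun v1 v2 =>
      ksign ((p + q) * wdeg u + q * wdeg v1 + (wdeg u - 1) * (wdeg v1 + p)) *:
        (phi (sw v1) * tau (sw u) (psi (sw v2))))) +
    ksign (p + q + 1) *: unsh w (fun u v =>
      ksign (q * (wdeg u - 1)) *: (phi (coder_of h (sw u)) * psi (sw v)) +
      ksign (-1 * wdeg u) *: (ksign (q * wdeg u) *:
        (phi (sw u) * psi (coder_of h (sw v)))))).
  congr (_ + _); rewrite -unshD; apply: eq_unsh => u v _ _.
  rewrite cup_sw // (unsh_lin _ _ (tau_linr _)) -unshD -unshZ.
  apply: eq_unsh => v1 v2 _ _; rewrite (lin_funZ _ _ (tau_linr _)).
  rewrite (tau_mul _ (phid _ _ (homog_sw v1)) (psid _ _ (homog_sw v2))).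
  by rewrite !scalerDr !scalerA -!ksignD.
(* Coassociativity collects the terms in which [tau] hits [phi]; where it hits [psi], the first two
   parts must first be exchanged. *)
rewrite (unsh_assoc w (fun u v1 v2 => _ *: (tau _ _ * _))).
rewrite (unsh_swap w (fun u v1 v2 => _ *: (phi _ * _))).
rewrite -unshZ -!unshD -unshZ -unshD; apply: eq_unsh => u v _ _.
rewrite !coder_act_sw // [(_ + _) * psi _]mulrDl [phi _ * (_ + _)]mulrDr.
rewrite unsh_mull unsh_mulr !scalerDr -!unshZ [RHS]addrACA -!addrA.
congr (_ + (_ + (_ + _))).
- apply: eq_unsh => u1 u2 du _; rewrite -!scalerAl !scalerA -du.
  by congr (_ *: _); ksolve.
- apply: eq_unsh => v1 v2 dv _; rewrite -!scalerAr !scalerA.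
  by congr (_ *: _); ksolve.
- by rewrite -!scalerAl !scalerA; congr (_ *: _); ksolve.
- by rewrite -!scalerAr !scalerA; congr (_ *: _); ksolve.
Qed.

(** The products are compositions of endomorphisms of [A], not brackets, so no factor 1/2 appears;
    [twedge_sw] links the two. *)
Definition curvature (x : S) (a : A) : A :=
  conv (fun m _ x' x'' => ksign m *: tau x' (tau x'' a)) x + tau (coder_of h x) a.

Lemma curvature_sw w a : curvature (sw w) a =
  unsh w (fun u v => ksign (wdeg u) *: tau (sw u) (tau (sw v) a))
  + tau (coder_of h (sw w)) a.
Proof.
rewrite /curvature conv_sw //; split=> m n x; apply: lin_scale.
  exact: tau_linl.
exact: (lin_comp (tau_linr x) (tau_linl a)).
Qed.

Lemma curvature_linr w : linear (curvature (sw w)).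
Proof.
move=> c a b; rewrite !curvature_sw scalerDr addrACA -unshZ -unshD.
congr (_ + _); last exact: tau_linr.
apply: eq_unsh => u v _ _; rewrite tau_linr tau_linr scalerDr.
by rewrite !scalerA [c * _]mulrC.
Qed.

Lemma coder_act_sq p phi w : hom_form p phi ->
  coder_act (p - 1) (coder_act p phi) (sw w) =
    unsh w (fun u v => ksign (p * wdeg u) *: curvature (sw u) (phi (sw v)))
    - phi (coder_of h (coder_of h (sw w))).
Proof.
move=> [phil phid]; have dphil := coder_act_linear p phil.
rewrite coder_act_sw // {2}/coder_act.
rewrite (conv_coder _ (coder_ofP hh) (tau_bil p phil)).
rewrite scalerDr addrA; congr (_ + _); last first.
  rewrite scalerA -scaleN1r; congr (_ *: _); rewrite -(ksign1 R); ksolve.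
transitivity (unsh w (fun u v => unsh v (fun v1 v2 =>
      ksign ((p - 1) * wdeg u + p * wdeg v1) *:
        tau (sw u) (tau (sw v1) (phi (sw v2))))) +
    unsh w (fun u v => ksign (p * wdeg u) *: tau (coder_of h (sw u)) (phi (sw v)))).
  rewrite -unshZ -!unshD; apply: eq_unsh => u v _ _.
  rewrite coder_act_sw // (lin_funD _ _ (tau_linr _)) (unsh_lin _ _ (tau_linr _)).
  rewrite (lin_funZ _ _ (tau_linr _)) !scalerDr !scalerA -unshZ -addrA.
  congr (_ + _).
    apply: eq_unsh => v1 v2 _ _; rewrite (lin_funZ _ _ (tau_linr _)) scalerA.
    by congr (_ *: _); ksolve.
  (* The terms [tau u (phi (H v))] arise once with [tau] outside and once with [H] outside, with
     opposite signs. *)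
  rewrite addrCA -scalerDl.
  have -> : ksign ((p - 1) * wdeg u) * ksign (p + 1) +
      ksign (p - 1 + 1) * ksign (-1 * wdeg u) * ksign (p * wdeg u) = 0 :> R.
    by apply/eqP; rewrite addr_eq0; apply/eqP; ksolve.
  by rewrite scale0r addr0; congr (_ *: _); ksolve.
rewrite (unsh_assoc w (fun u v1 v2 => _ *: _)) -unshD; apply: eq_unsh => u v _ _.
rewrite curvature_sw scalerDr -unshZ; congr (_ + _).
apply: eq_unsh => u1 u2 du _; rewrite scalerA -du; congr (_ *: _); ksolve.
Qed.


(** * The Leibniz rule and preservation of multilinear forms *)

Definition tau_multilinear : Prop := forall m a alpha w b, homog grA m a ->
  tau (sw (lact m a alpha :: w)) b = ksign m *: (a * tau (sw (alpha :: w)) b).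

(* The Leibniz rule of an sh Lie-Rinehart algebra, moved to the first slot. *)
Definition tau_leibniz : Prop := forall m a alpha w, homog grA m a ->
  h (sw (lact m a alpha :: w)) =
    ksign ((m + ldeg alpha) * wdeg w) *: act (tau (sw w) a) (lval alpha)
    + ksign m *: act a (h (sw (alpha :: w))).

(** Two defects of linearity cancel: [tau u (a * phi (alpha v))] leaves [tau u a * phi (alpha v)]
    because [tau u] is a derivation, and the Leibniz rule for [h] at [a alpha u] leaves the same
    product with opposite sign. *)
Lemma coder_act_multilinear p phi : tau_multilinear -> tau_leibniz ->
  sym_form p phi -> sym_form (p - 1) (coder_act p phi).
Proof.
move=> tm hlb [phil phid phim].
have [dl dd] := coder_act_form (conj phil phid); split=> //.
apply/multilinearP => // [a|m a alpha w ha]; first exact: (lin_mulr a (f := id)).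
have phim1 : forall m a alpha v, homog grA m a -> phi (sw (lact m a alpha :: v))
    = ksign (m * p) *: (a * phi (sw (alpha :: v))).
  by apply/multilinearP => // b; exact: (lin_mulr b (f := id)).
rewrite !coder_act_sw // !coder_of_sw // !(unsh_lin _ _ phil) !unsh_cons.
rewrite [a * (_ + _)]mulrDr -!scalerAr !unsh_mulr -!unshZ -!unshD -unshZ.
apply: eq_unsh => u v _ _.
pose K u := mkletter grL (wdeg u - 1) (h (sw u)).
(* The letter [a alpha] is an argument of [h]: the Leibniz rule splits the value, and linearity of
   [phi] extracts both [tau u a] and [a]. *)
have phi3 : phi (sw (K (lact m a alpha :: u) :: v)) =
    ksign ((m + ldeg alpha) * wdeg u) *: (ksign ((m + (wdeg u - 1)) * p) *:
      (tau (sw u) a * phi (sw (alpha :: v)))) +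
    ksign m *: (ksign (m * p) *: (a * phi (sw (K (alpha :: u) :: v)))).
  rewrite -(phim1 _ _ _ _ ha) -(phim1 _ _ _ _ (tau_homog u ha)) -!(lin_funZ _ _ phil).
  rewrite -(lin_funD _ _ phil); congr phi.
  rewrite /K hlb // -!lcons_sw (lin_funD _ _ (lconsl _ _)) !(lin_funZ _ _ (lconsl _ _)).
  rewrite !lcons_sw /lact wdeg_cons ldeg_lact ldeg_mk.
  rewrite wdeg_cons lval_mk; last first.
    by rewrite -wdeg_cons; apply: hh.2 (homog_sw (alpha :: u)).
  by congr (_ *: sw (mkletter _ _ _ :: _) + _ *: sw (mkletter _ _ _ :: _)); lia.
(* The letter [a alpha] stays outside [h], in second position behind [K u]. *)
have phi4 := phim m a [:: K u] alpha v ha.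
rewrite /= wdeg_cons wdeg_nil addr0 ldeg_mk in phi4.
rewrite phi3 phi4 tm // phim1 // (lin_funZ _ _ (tau_linr _)).
rewrite (tau_mul _ ha (phid _ _ (homog_sw (alpha :: v)))).
rewrite [a * (_ + _)]mulrDr [a * (_ + _ *: phi _)]mulrDr -!scalerAr.
rewrite !scalerDr !scalerA !wdeg_cons ldeg_lact -!addrA -!ksignD.
congr (_ + _); first by congr (_ *: _); ksolve.
rewrite [X in _ + X = _]addrCA [LHS]addrA -scalerDl.
have -> : ksign ((m + ldeg alpha) * wdeg u + p * wdeg u + m * p) +
    ksign (p + 1 + ((m + ldeg alpha) * wdeg u + (m + (wdeg u - 1)) * p)) = 0 :> R.
  by apply/eqP; rewrite addr_eq0; apply/eqP; ksolve.
rewrite scale0r add0r /K wdeg_cons -[ldeg alpha + _ - 1]addrA.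
by congr (_ *: _ + (_ *: _ + _ *: _)); ksolve.
Qed.

Lemma tau_leibnizP : tau_leibniz <->
  (forall w alpha m a, homog grA m a ->
     h (sw (rcons w (lact m a alpha))) =
       act (tau (sw w) a) (lval alpha)
       + ksign ((wdeg w + 1) * m) *: act a (h (sw (rcons w alpha)))).
Proof.
have hl := hh.1; split=> H.
  move=> w alpha m a ha; rewrite !sw_rcons !(lin_funZ _ _ hl) H //.
  rewrite (lin_funZ _ _ (act_linr a)) scalerDr !scalerA ldeg_lact.
  have -> : ksign (wdeg w * (m + ldeg alpha)) * ksign ((m + ldeg alpha) * wdeg w) = 1 :> R.
    by ksolve.
  by rewrite scale1r; congr (_ + _ *: _); ksolve.
move=> m a alpha w ha.
have e beta : h (sw (beta :: w)) = ksign (wdeg w * ldeg beta) *: h (sw (rcons w beta)).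
  by rewrite sw_rcons (lin_funZ _ _ hl) scalerA ksignMK scale1r.
rewrite !e H // (lin_funZ _ _ (act_linr a)) scalerDr !scalerA ldeg_lact.
by congr (_ *: _ + _ *: _); ksolve.
Qed.

(** * Detection by constants and by linear forms *)

Lemma coder_of_nilp w (N : lmodType R) (f : S -> N) : linear f ->
    (forall alpha v, f (sw (alpha :: v)) = 0) ->
  f (coder_of h (sw w)) = 0.
Proof.
by move=> fl f0; rewrite coder_of_sw // (unsh_lin _ _ fl); apply: unsh0.
Qed.

(** The inclusion of [A] as the forms supported on the empty word; [cup_one] is the case [a = 1]. *)
Definition cst_form (a : A) (x : S) : A := (counit x : R) *: a.

Lemma cst_form_sym p a : homog grA p a -> sym_form p (cst_form a).
Proof.
move=> ha; have cl : linear (cst_form a).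
  by move=> c x y; rewrite /cst_form counit_is_linear scalerDl scalerA.
split=> //.
  apply: degree_sw => // w; rewrite /cst_form counit_sw.
  by case: w => [|b w]; rewrite ?scale0r ?homog0 // wdeg_nil add0r scale1r.
apply/multilinearP => // [b|m b alpha v hb]; first exact: (lin_mulr b (f := id)).
by rewrite /cst_form !counit_sw /= !scale0r mulr0 scaler0.
Qed.

Lemma coder_act_cst p a w : homog grA p a ->
  coder_act p (cst_form a) (sw w) = ksign (p * wdeg w) *: tau (sw w) a.
Proof.
move=> ha; have [cl _ _] := cst_form_sym ha.
rewrite coder_act_sw // (coder_of_nilp w cl) ?scaler0 ?addr0; last first.
  by move=> alpha v; rewrite /cst_form counit_sw scale0r.
rewrite -[RHS](unsh_nilr w (fun u => ksign (p * wdeg u) *: tau (sw u) a)).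
apply: eq_unsh => u v _ _; rewrite /cst_form counit_sw.
by case: nilp; rewrite ?scale1r // scale0r (lin_fun0 (tau_linr _)) scaler0.
Qed.

Definition sdual_form (p : int) (f : sL -> A) : Prop :=
  [/\ linear f, degree_map grL grA p f &
      forall m a x, homog grA m a -> f (act a x) = ksign (m * p) *: (a * f x)].

Lemma sdual_sym p f : sdual_form p f -> sym_form p (fun x => f (corest x)).
Proof.
move=> [fl fd fm]; have cl := lin_comp fl (@corest_is_linear _ _ grL); split=> //.
  by move=> n x hx; apply: fd; rewrite -[n]addr0; exact: corest_homog.
apply/multilinearP => // [b|m b alpha v hb]; first exact: (lin_mulr b (f := id)).
rewrite !corest_sw; case: v => [|c v]; first by rewrite lval_lact // (fm _ _ _ hb).
by rewrite (lin_fun0 fl) mulr0 scaler0.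
Qed.

(** A form of degree [p] on [L] has degree [p - 1] on [sL], and the sign in the suspended action is
    the change this makes in the linearity rule. *)
Lemma sdual_sep n x y : bidual_injective L -> homog grL n x -> homog grL n y ->
  (forall p f, sdual_form p f -> f x = f y) -> x = y.
Proof.
move=> hL hx hy xy; apply: (hL (n - 1)) => // p f [fl fd fm].
rewrite /bidual (xy (p - 1) f) //; split=> //.
  by move=> k z hz; rewrite addrCA addrC; apply: fd.
move=> m a z ha; rewrite /= (susp_actE _ ha) (lin_funZ _ _ fl) (fm _ _ _ ha) scalerA.
by congr (_ *: _); ksolve.
Qed.

Lemma tau_multilinear_of_sym :
    (forall p phi, sym_form p phi -> sym_form (p - 1) (coder_act p phi)) ->
  tau_multilinear.
Proof.
move=> H m a alpha w b ha; move: b; apply: homog_ext => [||p b hb].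
- exact: tau_linr.
- by apply: lin_scale; apply: lin_mulr; exact: tau_linr.
have [dl _ dm] := H _ _ (cst_form_sym hb).
have := dm _ _ [::] alpha w ha.
rewrite /= !coder_act_cst // wdeg_nil addr0 !wdeg_cons ldeg_lact.
move=> /(congr1 (fun x => ksign (p * (m + ldeg alpha + wdeg w)) *: x)).
rewrite scalerA ksignMK scale1r => ->; rewrite -scalerAr !scalerA.
by congr (_ *: _); ksolve.
Qed.

(** Test on an [A]-linear form [f] on [sL]. On [a alpha :: w], apart from terms linear by
    [tau_multilinear], the operator has a term in [tau w (f (a alpha))], which contains
    [tau w a * f alpha], and a term in [f (h (a alpha :: w))], which must compensate it. Such [f]
    separate points. *)
Lemma tau_leibniz_of_sym : bidual_injective L ->
    (forall p phi, sym_form p phi -> sym_form (p - 1) (coder_act p phi)) ->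
  tau_leibniz.
Proof.
move=> hL H m a alpha w ha; have tm := tau_multilinear_of_sym H.
have hd beta : homog grL (ldeg beta + wdeg w - 1) (h (sw (beta :: w))).
  by rewrite -wdeg_cons; apply/hh.2/homog_sw.
have htw := tau_homog w ha.
apply: (@sdual_sep (m + ldeg alpha + wdeg w - 1)) => //.
- exact: (hd (lact m a alpha)).
- apply: homogP; last first.
    apply: homogZ; rewrite -!addrA; apply: act_homog => //; rewrite addrA; exact: hd.
  have -> : m + ldeg alpha + wdeg w - 1 = m + (wdeg w - 1) + ldeg alpha by lia.
  by apply: act_homog => //; exact: lvalP.
move=> p f fp; have [fl fd fm] := fp; have [cl _ cm] := sdual_sym fp.
have [dl _ dm] := H _ _ (sdual_sym fp).
(* The terms in which [beta] enters the argument of [tau]; multilinearity of [tau] handles them. *)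
pose Q beta := unsh w (fun u v =>
  ksign (p * (ldeg beta + wdeg u)) *: tau (sw (beta :: u)) (f (corest (sw v)))).
have key beta : coder_act p (fun x => f (corest x)) (sw (beta :: w)) =
    Q beta + ksign (ldeg beta * wdeg w + p * wdeg w) *: tau (sw w) (f (lval beta))
    + ksign (p + 1) *: f (h (sw (beta :: w))).
  rewrite coder_act_sw // corest_coder_of // unsh_cons unshD; congr (_ + _ + _).
    by apply: eq_unsh => u v _ _; rewrite wdeg_cons.
  rewrite -[RHS](unsh_nilr w (fun u =>
    ksign (ldeg beta * wdeg u + p * wdeg u) *: tau (sw u) (f (lval beta)))).
  apply: eq_unsh => u v _ _; rewrite corest_sw; case: v => [|c v] /=.
    by rewrite scalerA -ksignD.
  by rewrite (lin_fun0 fl) (lin_fun0 (tau_linr _)) !scaler0.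
have := dm m a [::] alpha w ha; rewrite wdeg_nil addr0 ![coder_act _ _ _]key.
rewrite ldeg_lact lval_lact // (fm _ _ _ ha) (lin_funZ _ _ (tau_linr _)).
have hfa : homog grA (ldeg alpha + p) (f (lval alpha)) by apply/fd/lvalP.
rewrite (tau_mul _ ha hfa).
have -> : Q (lact m a alpha) = ksign (m * (p - 1)) *: (a * Q alpha).
  rewrite /Q unsh_mulr -unshZ; apply: eq_unsh => u v _ _.
  by rewrite tm // ldeg_lact -scalerAr !scalerA; congr (_ *: _); ksolve.
rewrite [a * (_ + _)]mulrDr [a * (_ + _ *: tau _ _)]mulrDr -!scalerAr !scalerDr -!addrA.
move=> /addrI; rewrite !scalerA -!ksignD => e.
apply: (can_inj (g := fun x => ksign (p + 1) *: x)
  (f := fun x => ksign (p + 1) *: x : A)).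
  by move=> x; rewrite scalerA ksignMK scale1r.
rewrite [f (_ + _)](lin_funD _ _ fl) !(lin_funZ _ _ fl).
rewrite (fm _ _ _ htw) (fm _ _ _ ha) scalerDr !scalerA -!ksignD.
(* Adding the two summands of [tau w (a * f alpha)] makes [e] applicable; the one with [tau w a]
   then cancels against the Leibniz term. *)
apply: (addrI (ksign ((m + ldeg alpha) * wdeg w + p * wdeg w + m * p +
  (wdeg w - 1) * m) *: (a * tau (sw w) (f (lval alpha))))).
apply: (addrI (ksign ((m + ldeg alpha) * wdeg w + p * wdeg w + m * p) *:
  (tau (sw w) a * f (lval alpha)))).
rewrite {}e [X in _ = _ + X]addrCA [RHS]addrA -scalerDl.
set c := (X in _ = X *: _ + _); have -> : c = 0.
  by apply/eqP; rewrite addr_eq0; apply/eqP; ksolve.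
by rewrite scale0r add0r; congr (_ *: _ + _ *: _); ksolve.
Qed.

Definition no_curvature : Prop := forall w a, curvature (sw w) a = 0.

Lemma curvature_eq0_of_sq :
    (forall p phi w, sym_form p phi ->
      coder_act (p - 1) (coder_act p phi) (sw w) = 0) ->
  no_curvature.
Proof.
move=> H w; apply: homog_ext => [|c a b|p a ha]; first exact: curvature_linr.
  by rewrite scaler0 addr0.
have fa := cst_form_sym ha; have := H _ _ w fa.
rewrite (coder_act_sq _ (sym_form_hom fa)).
have [_ hd _] := coder_ofP hh.
(* The values of [coder_of h] lie in words of positive length, where a constant vanishes. *)
have -> : cst_form a (coder_of h (coder_of h (sw w))) = 0.
  have [cl _ _] := fa.
  rewrite -[LHS]/((fun x => cst_form a (coder_of h x)) (coder_of h (sw w))).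
  apply: coder_of_nilp => [|alpha v]; first exact: (lin_comp cl (coder_of_linear hh)).
  apply: coder_of_nilp => // alpha' v'.
  by rewrite /cst_form counit_sw scale0r.
rewrite subr0 => e.
have : ksign (p * wdeg w) *: curvature (sw w) a = 0.
  rewrite -[RHS]e.
  rewrite -[LHS](unsh_nilr w (fun u => ksign (p * wdeg u) *: curvature (sw u) a)).
  apply: eq_unsh => u v _ _; rewrite /cst_form counit_sw.
  by case: nilp; rewrite ?scale1r // scale0r (lin_fun0 (curvature_linr _)) scaler0.
move=> /(congr1 (fun x => ksign (p * wdeg w) *: x)).
by rewrite scalerA ksignMK scale1r scaler0.
Qed.

Lemma coder_act_sq0 p phi x : no_curvature ->
    (forall x, coder_of h (coder_of h x) = 0) -> hom_form p phi ->
  coder_act (p - 1) (coder_act p phi) x = 0.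
Proof.
move=> hc h0 hphi; have [phil _] := hphi.
move: x; apply: linear_sym_ext => [|c x y|w].
- by apply: coder_act_linear; exact: coder_act_linear.
- by rewrite scaler0 addr0.
rewrite coder_act_sq // h0 (lin_fun0 phil) subr0; apply: unsh0 => u v _ _.
by rewrite hc scaler0.
Qed.

Lemma corest_sq_of_sq w : bidual_injective L ->
    (forall p phi w, sym_form p phi ->
      coder_act (p - 1) (coder_act p phi) (sw w) = 0) ->
  corest (coder_of h (coder_of h (sw w))) = 0.
Proof.
move=> hL H; have hc := curvature_eq0_of_sq H; have [_ hd _] := coder_ofP hh.
apply: (@sdual_sep (wdeg w - 1 - 1)) => // [||p f fp].
- by rewrite -[_ - 1]addr0; apply/corest_homog/hd/hd/homog_sw.
- exact: homog0.
have [fl _ _] := fp; have := H _ _ w (sdual_sym fp).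
rewrite (coder_act_sq _ (sym_form_hom (sdual_sym fp))) unsh0 ?sub0r.
  by move=> /eqP; rewrite oppr_eq0 (lin_fun0 fl) => /eqP.
by move=> u v _ _; rewrite hc scaler0.
Qed.

End Tau.
End Operators.

(** * The differential graded algebra of multilinear forms *)

Section SymAlgebra.
Variables (R : comNzRingType) (A : cdga R) (L : dgModule A).
Local Notation sL := (susp L).
Local Notation grA := (cdga_gr A).
Local Notation grL := (dgm_gr sL).
Local Notation S := (Sym grL).
Local Notation grS := (sgrading grL).

Lemma sym_form_firstP p (phi : S -> A) :
  sym_form p phi <-> [/\ linear phi, degree_map grS grA p phi &
    forall m a alpha v, homog grA m a ->
      phi (sw (lact m a alpha :: v)) = ksign (m * p) *: (a * phi (sw (alpha :: v)))].
Proof.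
have ml (a : A) : linear ( *%R a) by exact: (lin_mulr a (f := id)).
by split=> -[phil phid phim]; split=> //; apply/(multilinearP p ml phil).
Qed.

Lemma sym_form0 p : sym_form p (0 : S -> A).
Proof.
split=> [c x y|n x _|m a u alpha v _] /=; first by rewrite scaler0 addr0.
  exact: homog0.
by rewrite mulr0 scaler0.
Qed.

Lemma sym_formP p c (phi psi : S -> A) :
  sym_form p phi -> sym_form p psi -> sym_form p (c *: phi + psi).
Proof.
move=> [phil phid phim] [psil psid psim]; split.
- exact: (lin_add (lin_scale c phil) psil).
- by move=> n x hx; apply: homogP; [exact: phid|exact: psid].
move=> m a u alpha v ha.
rewrite -[LHS]/(c *: phi _ + psi _) phim // psim //.
rewrite -[X in _ = _ *: (_ * X)]/(c *: phi _ + psi _).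
by rewrite [a * (_ + _)]mulrDr -!scalerAr scalerDr !scalerA [c * _]mulrC.
Qed.

Lemma cup_sym_form p q (phi psi : S -> A) :
  sym_form p phi -> sym_form q psi -> sym_form (p + q) (cup p q phi psi).
Proof.
move=> /sym_form_firstP[phil phid phim] /sym_form_firstP[psil psid psim].
have cl := cup_linear p q phil psil; apply/sym_form_firstP; split=> //.
  apply: degree_sw => // w; rewrite cup_sw //; apply: homog_unsh => u v <-.
  apply: homogZ; rewrite addrACA.
  by apply: (cdga_mul (cdgaP A)); [exact: phid (homog_sw u)|exact: psid (homog_sw v)].
move=> m a alpha w ha; rewrite !cup_sw // !unsh_cons unsh_mulr -unshZ.
apply: eq_unsh => u v _ _; rewrite phim // psim // ldeg_lact.
(* If [a alpha] falls into the argument of [psi], then [a] has to pass [phi u]; graded commutativity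
   of [A] is used here. *)
have := cdga_mulC (cdgaP A) (phid _ _ (homog_sw u)) ha => c.
rewrite -!scalerAr mulrA c [a * (_ + _)]mulrDr -!scalerAr -!scalerAl !wdeg_cons.
rewrite ldeg_lact [X in _ = X]scalerDr !scalerA !mulrA.
by congr (_ *: _ + _ *: _); ksolve.
Qed.

Lemma cup_assoc (p q r : int) (phi psi chi : S -> A) :
    linear phi -> linear psi -> linear chi ->
  cup p (q + r) phi (cup q r psi chi) = cup (p + q) r (cup p q phi psi) chi.
Proof.
move=> phil psil chil; have l1 := cup_linear q r psil chil.
have l2 := cup_linear p q phil psil; apply/funext.
apply: linear_sym_ext => [||w]; [exact: cup_linear|exact: cup_linear|].
rewrite !cup_sw //.
transitivity (unsh w (fun u v => unsh v (fun v1 v2 =>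
    ksign ((q + r) * wdeg u + r * wdeg v1) *:
      (phi (sw u) * psi (sw v1) * chi (sw v2))))).
  apply: eq_unsh => u v _ _; rewrite cup_sw // unsh_mulr -unshZ.
  apply: eq_unsh => v1 v2 _ _; rewrite -scalerAr scalerA mulrA.
  by congr (_ *: _); ksolve.
rewrite (unsh_assoc w (fun u v1 v2 => _ *: _)); apply: eq_unsh => u v _ _.
rewrite cup_sw // unsh_mull -unshZ; apply: eq_unsh => u1 u2 du _.
by rewrite -scalerAl scalerA -du; congr (_ *: _); ksolve.
Qed.

Lemma cup_comm (p q : int) (phi psi : S -> A) : hom_form p phi -> hom_form q psi ->
  cup p q phi psi = ksign (p * q) *: cup q p psi phi.
Proof.
move=> [phil phid] [psil psid]; apply/funext; apply: linear_sym_ext.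
- exact: cup_linear.
- by apply: lin_scale; exact: cup_linear.
move=> w; rewrite -[RHS]/(_ *: cup q p psi phi (sw w)) !cup_sw // unsh_comm -unshZ.
apply: eq_unsh => u v _ _.
rewrite (cdga_mulC (cdgaP A) (phid _ _ (homog_sw v)) (psid _ _ (homog_sw u))).
by rewrite !scalerA; congr (_ *: _); ksolve.
Qed.

Lemma cup_onel p (phi : S -> A) : linear phi -> cup 0 p (@cup_one R A L) phi = phi.
Proof.
move=> phil; have onel : linear (@cup_one R A L).
  by have [] := cst_form_sym L (cdga_one (cdgaP A)).
apply/funext; apply: linear_sym_ext => //; first exact: cup_linear.
move=> w; rewrite cup_sw // -[RHS](unsh_nill w (fun v => phi (sw v))).
apply: eq_unsh => u v _ _; rewrite /cup_one counit_sw.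
case: u => [|a u]; rewrite ?scale0r ?mul0r ?scaler0 //.
by rewrite wdeg_nil mulr0 !scale1r mul1r.
Qed.

Lemma cup_linl (p q : int) (c : R) (phi phi' psi : S -> A) :
    linear phi -> linear phi' -> linear psi ->
  cup p q (c *: phi + phi') psi = c *: cup p q phi psi + cup p q phi' psi.
Proof.
move=> phil phil' psil; have sl : linear (c *: phi + phi').
  exact: (lin_add (lin_scale c phil) phil').
apply/funext; apply: linear_sym_ext; first exact: cup_linear.
  by apply: (lin_add (lin_scale c _)); exact: cup_linear.
move=> w; rewrite -[RHS]/(c *: cup _ _ _ _ _ + cup _ _ _ _ _) !cup_sw //.
rewrite -unshZ -unshD; apply: eq_unsh => u v _ _.
rewrite -[(c *: phi + phi') _]/(c *: phi _ + phi' _) mulrDl -scalerAl scalerDr.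
by rewrite !scalerA [c * _]mulrC.
Qed.

Lemma cup_linr (p q : int) (c : R) (phi psi psi' : S -> A) :
    linear phi -> linear psi -> linear psi' ->
  cup p q phi (c *: psi + psi') = c *: cup p q phi psi + cup p q phi psi'.
Proof.
move=> phil psil psil'; have sl : linear (c *: psi + psi').
  exact: (lin_add (lin_scale c psil) psil').
apply/funext; apply: linear_sym_ext; first exact: cup_linear.
  by apply: (lin_add (lin_scale c _)); exact: cup_linear.
move=> w; rewrite -[RHS]/(c *: cup _ _ _ _ _ + cup _ _ _ _ _) !cup_sw //.
rewrite -unshZ -unshD; apply: eq_unsh => u v _ _.
rewrite -[(c *: psi + psi') _]/(c *: psi _ + psi' _) mulrDr -scalerAr scalerDr.
by rewrite !scalerA [c * _]mulrC.
Qed.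

Local Notation comp := (@sym_form R A L).

Section Operator.
Variables (tau : S -> A -> A) (h : S -> sL).
Hypotheses (htau : der_cochain tau) (hh : corest_deg h).
Hypotheses (tm : tau_multilinear tau) (tl : tau_leibniz tau h).

Lemma coder_act_gr_linear : is_gr_linear comp (-1) (coder_act tau h).
Proof.
split=> [p phi hphi|p c phi psi [phil _ _] [psil _ _]].
  exact: coder_act_multilinear.
exact: coder_act_linp.
Qed.

Lemma coder_act_gr_der :
  is_gr_der comp (@cup R A L) (-1) (coder_act tau h).
Proof.
split; first exact: coder_act_gr_linear.
by move=> p q phi psi /sym_form_hom hphi /sym_form_hom hpsi; exact: coder_act_cup.
Qed.

Lemma coder_act_differential :
    no_curvature tau h -> (forall x, coder_of h (coder_of h x) = 0) ->
  is_differential comp (coder_act tau h).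
Proof.
move=> hc h0; split; first exact: coder_act_gr_linear.
move=> p phi /sym_form_hom hphi; apply/funext => x.
exact: coder_act_sq0.
Qed.

End Operator.

(** The differential of [A] as a cochain supported on the empty word. Paired with [h0] it puts [D_0]
    on the same footing as the [D_j], and in the sum with [t] it produces the commutator with
    [d_A]. *)
Definition tau0 (x : S) (a : A) : A := (counit x : R) *: cdga_d A a.

Definition h0 (x : S) : sL := dgm_d sL (corest x).

Lemma tau0_sw w a : tau0 (sw w) a = if nilp w then cdga_d A a else 0.
Proof. by rewrite /tau0 counit_sw; case: nilp; rewrite ?scale1r ?scale0r. Qed.

Lemma tau0_der : der_cochain tau0.
Proof.
split.
  move=> c x y; apply/funext => a.
  by rewrite /tau0 counit_is_linear scalerDl -scalerA.
move=> w; have e : tau0 (sw w) = if nilp w then cdga_d A : A -> A else 0.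
  by apply/funext => a; rewrite tau0_sw; case: nilp.
rewrite e; case: w {e} => [|a w]; last exact: is_der0.
by rewrite wdeg_nil; exact: is_der_d.
Qed.

Lemma h0_deg : corest_deg h0.
Proof.
split; first by apply: (lin_comp _ (@corest_is_linear _ _ _)); exact: linearP.
by move=> n x hx; apply: dgm_d_deg; rewrite -[n]addr0; exact: corest_homog.
Qed.

Lemma tau0_multilinear : tau_multilinear tau0.
Proof. by move=> m a alpha w b _; rewrite !tau0_sw /= mulr0 scaler0. Qed.

(** For empty [w] this is compatibility of the differential on [sL] with the action of [A]; for
    longer words all terms vanish. *)
Lemma tau0_leibniz : tau_leibniz tau0 h0.
Proof.
move=> m a alpha w ha; rewrite tau0_sw /h0 !corest_sw; case: w => [|b w] /=.
  by rewrite lval_lact // wdeg_nil mulr0 scale1r -(dgm_d_act (lval alpha) ha).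
rewrite (lin_fun0 (@susp_d_is_linear _ _ L)).
by rewrite (lin_fun0 (susp_actl (L := L) _)) (lin_fun0 (susp_actr _)) !scaler0 addr0.
Qed.

Lemma cdga_d_sq (a : A) : cdga_d A (cdga_d A a) = 0.
Proof.
have dl : linear (cdga_d A) by exact: linearP.
move: a; apply: (homog_ext (G := grA) (lin_comp dl dl)) => [c a b|p a ha].
  by rewrite scaler0 addr0.
exact: (cdga_dd (cdgaP A)).2 ha.
Qed.

Lemma sym_D0E p phi : linear phi -> sym_D0 p phi = coder_act tau0 h0 p phi.
Proof.
move=> phil; apply/funext; apply: linear_sym_ext.
- apply: lin_add; first by apply: (lin_comp (f := cdga_d A)) => //; exact: linearP.
  by apply: lin_scale; apply: (lin_comp phil); exact: coder_of_linear h0_deg.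
- by apply: coder_act_linear => //; [exact: tau0_der|exact: h0_deg].
move=> w; rewrite coder_act_sw //; last exact: tau0_der.
congr (_ + _); rewrite -[LHS](unsh_nill w (fun v => cdga_d A (phi (sw v)))).
apply: eq_unsh => u v _ _; rewrite tau0_sw.
by case: u => [|a u]; rewrite ?scaler0 // wdeg_nil mulr0 scale1r.
Qed.

Variable iota : {rmorphism rat -> R}.

Lemma sym_d0_sq (x : S) : coder_of h0 (coder_of h0 x) = 0.
Proof.
have hd := h0_deg; move: x.
apply: (coder_eq0 iota (coder_deg_sq (coder_ofP hd))) => w.
rewrite corest_coder_of // /h0 corest_coder_of // /h0.
exact: (@susp_dd R A L).
Qed.

Lemma tau0_no_curvature : no_curvature tau0 h0.
Proof.
move=> w a; rewrite curvature_sw; last exact: tau0_der.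
rewrite unsh0 ?add0r; last first.
  have dl : linear (cdga_d A) by exact: linearP.
  by move=> u v _ _; rewrite /tau0 (lin_funZ _ _ dl) cdga_d_sq !scaler0.
apply: (coder_of_nilp h0_deg w (f := fun x => tau0 x a)).
  by apply: tau_linl; exact: tau0_der.
by move=> alpha v; rewrite tau0_sw.
Qed.

Lemma sym_cdga : is_cdga comp (@cup R A L) (@cup_one R A L) (@sym_D0 R A L).
Proof.
have e p phi : comp p phi -> sym_D0 p phi = coder_act tau0 h0 p phi.
  by case=> phil _ _; exact: sym_D0E.
have hD := coder_act_gr_der tau0_der h0_deg tau0_multilinear tau0_leibniz.
have hd := coder_act_differential tau0_der h0_deg tau0_multilinear tau0_leibniz
  tau0_no_curvature sym_d0_sq.
have hl : is_gr_linear comp (-1) (@sym_D0 R A L).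
  split=> [p phi hphi|p c phi psi hphi hpsi]; first by rewrite e //; exact: hD.1.1.
  by rewrite !e //; [exact: hD.1.2|exact: sym_formP].
split.
- exact: sym_form0.
- by move=> *; exact: sym_formP.
- by move=> *; exact: cup_sym_form.
- by move=> p q c phi phi' psi [? ? ?] [? ? ?] [? ? ?]; exact: cup_linl.
- by move=> p q c phi phi' psi [? ? ?] [? ? ?] [? ? ?]; exact: cup_linr.
- by move=> p q r phi psi chi [? ? ?] [? ? ?] [? ? ?]; exact: cup_assoc.
- by move=> p q phi psi /sym_form_hom ? /sym_form_hom ?; exact: cup_comm.
- exact: cst_form_sym (cdga_one (cdgaP A)).
- by move=> p phi [? ? ?]; exact: cup_onel.
- split=> // p q phi psi hphi hpsi; rewrite !e //; first exact: hD.2.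
  exact: cup_sym_form.
- split=> // p phi hphi; rewrite !e //; first exact: hd.2.
  by rewrite -e //; exact: hl.1.
Qed.

End SymAlgebra.

Section SumLemmas.
Variables (R : comNzRingType).

Lemma sum_delta (V : zmodType) (k n : nat) (x : V) : (0 < k < n)%N ->
  \sum_(1 <= j < n) (if k == j then x else 0) = x.
Proof.
move=> kn; rewrite (bigD1_seq k) ?iota_uniq ?mem_index_iota //= eqxx.
by rewrite big1 ?addr0 // => i; rewrite eq_sym => /negbTE ->.
Qed.

Lemma unsh_sum (V : lmodType R) (G : grading V) (N : lmodType R) w
    (I : Type) (r : seq I) (F : I -> seq (letter G) -> seq (letter G) -> N) :
  \sum_(i <- r) unsh w (F i) = unsh w (fun u v => \sum_(i <- r) F i u v).
Proof.
elim: r => [|i r ih].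
  by rewrite big_nil unsh0 // => u v _ _; rewrite big_nil.
rewrite big_cons ih -unshD; apply: eq_unsh => u v _ _.
by rewrite big_cons.
Qed.

End SumLemmas.

(** * Additivity and weight of the operators *)

Section Additivity.
Variables (R : comNzRingType) (A : cdga R) (L : dgModule A).
Local Notation sL := (susp L).
Local Notation grL := (dgm_gr sL).
Local Notation S := (Sym grL).

Lemma coder_act0 (tau : S -> A -> A) (h : S -> sL) p w :
  der_cochain tau -> coder_act tau h p 0 (sw w) = 0.
Proof.
move=> htau; have l0 : linear (0 : S -> A).
  by move=> c x y; rewrite /= scaler0 addr0.
rewrite coder_act_sw // scaler0 addr0; apply: unsh0 => u v _ _.
by rewrite (lin_fun0 (tau_linr htau _)) scaler0.
Qed.

(** Removing [j] letters for [tau], or replacing [j + 1] letters by one for [h], shortens a word by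
    [j]. Taking [psi = 0] gives the filtration shift, taking [psi] a component of [phi] gives
    sharpness. *)
Lemma coder_act_weight (tau : S -> A -> A) (h : S -> sL) j p phi psi w :
    der_cochain tau -> corest_deg h -> linear phi -> linear psi ->
    (forall u, size u != j -> tau (sw u) = 0) ->
    (forall u, size u != j.+1 -> h (sw u) = 0) ->
    (forall v, (size v + j)%N = size w -> phi (sw v) = psi (sw v)) ->
  coder_act tau h p phi (sw w) = coder_act tau h p psi (sw w).
Proof.
move=> htau hh phil psil tj hj e; rewrite !coder_act_sw //; congr (_ + _ *: _).
  apply: eq_unsh => u v _ s; have [uj|uj] := eqVneq (size u) j.
    by rewrite e // -s uj addnC.
  by rewrite tj.
rewrite !coder_of_sw // (unsh_lin _ _ phil) (unsh_lin _ _ psil).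
apply: eq_unsh => u v _ s; have [uj|uj] := eqVneq (size u) j.+1.
  by apply: e; rewrite /= -s uj addnC addSnnS.
by rewrite hj // -lcons_sw (lin_fun0 (lconsl _ _)) (lin_fun0 phil) (lin_fun0 psil).
Qed.

Variables (tau tau' : S -> A -> A) (h h' : S -> sL).
Hypotheses (htau : der_cochain tau) (htau' : der_cochain tau').
Hypotheses (hh : corest_deg h) (hh' : corest_deg h').

Lemma der_cochainD : der_cochain (fun x => tau x + tau' x).
Proof.
split; first by apply: lin_add; [exact: htau.1|exact: htau'.1].
move=> w; have [dl dd dm] := is_derP (htau.2 w).
have [dl' dd' dm'] := is_derP (htau'.2 w).
have sl : linear (tau (sw w) + tau' (sw w)) by exact: (lin_add dl dl').
split=> //; split; first split.
- by move=> m a ha; apply: homogD; [exact: dd|exact: dd'].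
- by move=> m c a b _ _; exact: sl.
move=> m n a b ha hb; rewrite -[LHS]/(tau (sw w) (a * b) + tau' (sw w) (a * b)).
rewrite (dm _ _ _ _ ha hb) (dm' _ _ _ _ ha hb) addrACA -scalerDr.
by rewrite -mulrDl -mulrDr.
Qed.

Lemma corest_degD : corest_deg (fun x => h x + h' x).
Proof.
split; first by apply: lin_add; [exact: hh.1|exact: hh'.1].
by move=> n x hx; apply: homogD; [exact: hh.2|exact: hh'.2].
Qed.

Lemma coder_actD p phi x : linear phi ->
  coder_act (fun x => tau x + tau' x) (fun x => h x + h' x) p phi x =
    coder_act tau h p phi x + coder_act tau' h' p phi x.
Proof.
move=> phil; have ht := der_cochainD; have hd := corest_degD.
move: x; apply: linear_sym_ext.
- exact: coder_act_linear.
- by apply: lin_add; exact: coder_act_linear.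
move=> w; rewrite !coder_act_sw // coder_ofD // (lin_funD _ _ phil).
rewrite [_ *: (phi _ + phi _)]scalerDr [RHS]addrACA -unshD; congr (_ + _).
apply: eq_unsh => u v _ _; rewrite -scalerDr.
by [].
Qed.

Lemma tau_multilinearD : tau_multilinear tau -> tau_multilinear tau' ->
  tau_multilinear (fun x => tau x + tau' x).
Proof.
move=> tm tm' m a alpha w b ha.
rewrite -[LHS]/(tau _ b + tau' _ b) (tm _ _ _ _ _ ha) (tm' _ _ _ _ _ ha).
by rewrite -scalerDr -mulrDr.
Qed.

Lemma tau_leibnizD : tau_leibniz tau h -> tau_leibniz tau' h' ->
  tau_leibniz (fun x => tau x + tau' x) (fun x => h x + h' x).
Proof.
move=> tl tl' m a alpha w ha; rewrite (tl _ _ _ _ ha) (tl' _ _ _ _ ha) addrACA.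
rewrite -!scalerDr; congr (_ *: _ + _ *: _).
  by rewrite -(lin_funD _ _ (act_linl _)).
by rewrite -(lin_funD _ _ (act_linr _)).
Qed.

End Additivity.

(** * Completeness of the filtration *)

Section Filtration.
Variables (R : comNzRingType) (A : cdga R) (L : dgModule A).
Local Notation sL := (susp L).
Local Notation grL := (dgm_gr sL).
Local Notation S := (Sym grL).
Local Notation comp := (@sym_form R A L).

Lemma sym_filP l (phi : S -> A) : linear phi ->
  sym_fil l phi <-> forall w, (size w < l)%N -> phi (sw w) = 0.
Proof.
move=> phil; split=> h; first by move=> w wl; apply/h/coaug_sw.
move=> x; apply: (linear_coaug_ext phil) => // c y z.
by rewrite scaler0 addr0.
Qed.

(** A Cauchy sequence is eventually constant on the words of any bounded length, so its limit is
    defined word by word. *)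
Lemma sym_complete (D : nat -> int -> (S -> A) -> (S -> A)) :
  fil_complete (sym_data D).
Proof.
move=> p u /= up cauchy; have [N hN] := choice cauchy.
have ul n : linear (u n) by have [] := up n.
have st l w m n : (size w < l)%N -> (N l <= m)%N -> (N l <= n)%N ->
    u m (sw w) = u n (sw w).
  move=> wl lm ln; apply/eqP; rewrite -subr_eq0; apply/eqP.
  exact: (hN l m n lm ln _ (coaug_sw wl)).
pose f (w : seq (letter grL)) := u (N (size w).+1) (sw w).
(* The index chosen in [f] depends only on the length of the word, which the defining relations
   preserve; [f] inherits them from a single [u n]. *)
have fc : pcompat (@sym_rel _ _ grL) f.
  apply: sym_compat => [w v n c x y|w v a b]; rewrite /f !size_cat /=.
    by rewrite sw_lin ul.
  by rewrite sw_comm (lin_funZ _ _ (ul _)).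
pose phi := plift f : S -> A.
have phil : linear phi by exact: plift_is_linear fc.
have phiE w : phi (sw w) = f w by exact: plift_gen fc w.
have lim l w n : (size w < l)%N -> (N l <= n)%N -> phi (sw w) = u n (sw w).
  move=> wl ln; rewrite phiE /f.
  rewrite (st _ w _ (maxn (N l) (N (size w).+1)) (ltnSn _) (leqnn _)) ?leq_maxr //.
  by rewrite (st l w _ n wl) // leq_maxl.
have phis : comp p phi.
  apply/sym_form_firstP; split=> // [|m a alpha v ha].
    apply: degree_sw => // w; rewrite phiE.
    by have [_ d _] := up (N (size w).+1); exact/d/homog_sw.
  have /sym_form_firstP[_ _ um] := up (N (size v).+2).
  by rewrite !phiE /f /= um.
exists phi; split.
  split=> // l; exists (N l) => n ln x.
  have dl : linear (phi - u n).
    by move=> c y z; rewrite /= -[LHS]/(phi _ - u n _) phil ul opprD addrACA scalerBr.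
  apply/sym_filP: x => // w wl.
  by rewrite -[LHS]/(phi _ - u n _) (lim l w n) // subrr.
move=> psi [[psil _ _] hpsi]; apply/funext; apply: linear_sym_ext => // w.
have [N' hN'] := hpsi (size w).+1.
pose n := maxn (N (size w).+1) N'.
rewrite (lim _ w n (ltnSn _)) ?leq_maxl //; apply/eqP; rewrite eq_sym -subr_eq0.
by apply/eqP; apply: (hN' n _ _ (coaug_sw (ltnSn _))); exact: leq_maxr.
Qed.

End Filtration.

Lemma unsh_app (R : comNzRingType) (V : lmodType R) (G : grading V) (T : Type)
    (N : lmodType R) w (F : seq (letter G) -> seq (letter G) -> T -> N) x :
  unsh w F x = unsh w (fun u v => F u v x).
Proof. by elim: w F => [//|a w ih] F /=; rewrite ih. Qed.

(** * The operators of an sh Lie-Rinehart structure *)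

Section Data.
Variables (R : comNzRingType) (iota : {rmorphism rat -> R}).
Variables (A : cdga R) (L : dgModule A).
Local Notation sL := (susp L).
Local Notation grA := (cdga_gr A).
Local Notation grL := (dgm_gr sL).
Local Notation act := (@dgm_act R A sL).
Local Notation S := (Sym grL).
Local Notation grS := (sgrading grL).
Local Notation comp := (@sym_form R A L).

Variables (par : S -> S) (t : S -> A -> A).
Hypotheses (hpar : is_filtered_coder par) (ht : is_filtered_morphism t).

Let par_deg : coder_deg (-1) par.
Proof. exact: is_coder_deg hpar.1. Qed.

Definition hpart (x : S) : sL := corest (par x).

Lemma hpart_deg : corest_deg hpart.
Proof. exact: corest_coder_deg par_deg. Qed.

Lemma parE x : par x = coder_of hpart x.
Proof. exact: (coder_ofE iota x par_deg hpart_deg). Qed.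

Let cons_deg j : corest_deg (constituent par j).
Proof. exact: constituent_deg. Qed.

Lemma t_der : der_cochain t.
Proof. by case: ht => tl td _; split=> // w; exact: td (homog_sw w). Qed.

Lemma tcomp_sw j w : tcomp t j (sw w) = if size w == j then t (sw w) else 0.
Proof. by rewrite /tcomp wproj_sw; case: ifP => // _; exact: lin_fun0 t_der.1. Qed.

Lemma tcomp_der j : der_cochain (tcomp t j).
Proof.
split; first by apply: (lin_comp t_der.1); exact: wproj_is_linear.
by move=> w; rewrite tcomp_sw; case: ifP => _; [exact: t_der.2|exact: is_der0].
Qed.

Lemma sym_DjE j : sym_Dj par t j = coder_act (tcomp t j) (constituent par j).
Proof. by []. Qed.

Lemma hpart_le1 w : (size w <= 1)%N -> hpart (sw w) = 0.
Proof. exact: corest_filtered. Qed.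

Lemma constituent_hpart j w :
  constituent par j (sw w) = if size w == j.+1 then hpart (sw w) else 0.
Proof. by rewrite constituent_sw //; case: par_deg. Qed.

Lemma sum_tcomp n w : (size w < n)%N ->
  \sum_(1 <= j < n) tcomp t j (sw w) = t (sw w).
Proof.
move=> wn; rewrite (eq_bigr _ (fun j _ => tcomp_sw j w)).
have [w0|w0] := posnP (size w); last by rewrite sum_delta // w0.
have -> : t (sw w) = 0 by case: ht => _ _; rewrite (size0nil w0).
by rewrite big1 // => j _; case: ifP.
Qed.

(** The constituent of index [j] lives on length [j + 1], so the sum from 1 reaches lengths 2 to
    [n]; on shorter words [hpart] vanishes because [par] lowers the filtration. *)
Lemma sum_constituent n w : (size w <= n)%N ->
  \sum_(1 <= j < n) constituent par j (sw w) = hpart (sw w).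
Proof.
move=> wn; rewrite (eq_bigr _ (fun j _ => constituent_hpart j w)).
have [w1|w1] := leqP (size w) 1.
  by rewrite hpart_le1 // big1 // => j _; case: ifP.
rewrite -[RHS](@sum_delta _ (size w).-1 n); last by lia.
apply: eq_bigr => j _; congr (if _ then _ else _).
by case: (size w) w1.
Qed.

Lemma sum_coder_comp n w : (size w <= n)%N ->
  \sum_(1 <= j < n) coder_comp par j (sw w) = coder_of hpart (sw w).
Proof.
move=> wn; rewrite (eq_bigr _ (fun j _ => coder_of_sw (cons_deg j) w)) unsh_sum.
rewrite coder_of_sw; last exact: hpart_deg.
apply: eq_unsh => u v _ s; under eq_bigr => j _ do rewrite -lcons_sw.
rewrite -(lin_sum _ _ _ (lconsl (wdeg u - 1) (sw v))) sum_constituent ?lcons_sw //.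
by lia.
Qed.

(** On a fixed word the series is finite. Both its convergence and the identification of its sum
    follow from this. *)
Lemma sum_sym_Dj n p phi w : linear phi -> (size w < n)%N ->
  (\sum_(1 <= j < n) sym_Dj par t j p phi) (sw w) =
    coder_act t hpart p phi (sw w).
Proof.
move=> phil wn; rewrite (@lin_sum _ _ _ _ _ _ (fun g : S -> A => g (sw w))) //.
under eq_bigr => j _ do
  rewrite sym_DjE (coder_act_sw (tcomp_der j) _ _ _ phil).
rewrite big_split /= unsh_sum -scaler_sumr -(lin_sum _ _ _ phil).
rewrite sum_coder_comp ?(ltnW wn) // coder_act_sw //; last exact: t_der.
congr (_ + _); apply: eq_unsh => u v _ s.
rewrite -scaler_sumr -(@sum_tcomp n u).
  2: by rewrite (leq_ltn_trans _ wn) // -s leq_addr.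
by rewrite (@lin_sum _ _ _ _ _ _ (fun g : A -> A => g (phi (sw v)))).
Qed.

(** * The total operator and the twisting cochain equation *)

Definition total_tau (x : S) : A -> A := tau0 x + t x.

Definition total_h (x : S) : sL := h0 x + hpart x.

Lemma total_dE x : total_d par x = coder_of total_h x.
Proof.
by rewrite /total_d parE coder_ofD //; [exact: h0_deg|exact: hpart_deg].
Qed.

Lemma total_tau_der : der_cochain total_tau.
Proof. by apply: der_cochainD; [exact: tau0_der|exact: t_der]. Qed.

Lemma total_h_deg : corest_deg total_h.
Proof. by apply: corest_degD; [exact: h0_deg|exact: hpart_deg]. Qed.

Lemma total_coder_act p phi : linear phi ->
  coder_act total_tau total_h p phi =
    sym_D0 p phi + coder_act t hpart p phi.
Proof.
move=> phil; rewrite sym_D0E //; apply/funext => x.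
by apply: coder_actD => //; [exact: tau0_der|exact: t_der|exact: h0_deg|exact: hpart_deg].
Qed.

Lemma iota_half (N : lmodType R) (x : N) : iota (2%:R^-1) *: (x + x) = x.
Proof.
rewrite -{1 2}[x]scale1r -scalerDl scalerA -(rmorph1 iota) -rmorphD -rmorphM.
by rewrite -[1 + 1]/(2%:R) mulVf // rmorph1 scale1r.
Qed.

Lemma twedge_bil : bilinear_family (fun m n x' x'' =>
  ksign (-1 * m) *: der_bracket (m - 1) (n - 1) (t x') (t x'')).
Proof.
have tl := t_der.1; have tr x := tau_linr t_der x.
split=> m n x c y z; apply/funext => a; rewrite tl /der_bracket;
  rewrite -[LHS]/(_ *: (_ - _)) -[RHS]/(c *: (_ *: (_ - _)) + _ *: (_ - _)).
- rewrite -[(c *: t y + t z) (t x a)]/(c *: t y (t x a) + t z (t x a)).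
  rewrite -[(c *: t y + t z) a]/(c *: t y a + t z a) tr.
  rewrite !scalerDr !scalerN !scalerDr !scalerA opprD addrACA.
  by rewrite !mulrA ![_ * c]mulrC !mulrA.
- rewrite -[(c *: t y + t z) (t x a)]/(c *: t y (t x a) + t z (t x a)).
  rewrite -[(c *: t y + t z) a]/(c *: t y a + t z a) tr.
  rewrite !scalerDr !scalerN !scalerDr !scalerA opprD addrACA.
  by rewrite !mulrA ![_ * c]mulrC !mulrA.
Qed.

(** By graded cocommutativity the two halves of the commutator contribute equally, and 1/2 removes
    the doubling. *)
Lemma twedge_sw w a : twedge iota t (sw w) a =
  unsh w (fun u v => ksign (wdeg u) *: t (sw u) (t (sw v) a)).
Proof.
rewrite /twedge conv_sw; last exact: twedge_bil.
rewrite -[LHS]/(_ *: (unsh w _ a)) unsh_app -[RHS]iota_half.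
congr (_ *: _); rewrite [X in _ = _ + X]unsh_comm -unshD; apply: eq_unsh => u v _ _.
rewrite -[LHS]/(_ *: (_ - _)) scalerDr scalerN !scalerA -scaleNr.
by congr (_ *: _ + _ *: _); ksolve.
Qed.

(** Expanding [d_A + t] in the curvature, [d_A d_A] vanishes, the mixed products form the bracket
    with [d_A], and [t t] is the wedge. In the last term [tau0] vanishes on the image of the
    coderivation. *)
Lemma twisting_curvature w a :
  (hom_diff (total_d par) (der_bracket (-1) (wdeg w - 1) (cdga_d A)) (-1) t (sw w)
   + twedge iota t (sw w)) a = curvature total_tau total_h (sw w) a.
Proof.
have hh := total_h_deg; have tr x := tau_linr t_der x.
rewrite curvature_sw //; last exact: total_tau_der.
have -> : total_tau (coder_of total_h (sw w)) a = t (total_d par (sw w)) a.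
  rewrite total_dE -[LHS]/(tau0 _ a + t _ a).
  have := coder_of_nilp hh w (tau_linl (@tau0_der _ _ L) a).
  by move=> ->; rewrite ?add0r // => alpha v; rewrite tau0_sw.
rewrite -[LHS]/(_ - _ + _ *: t _ a + _) twedge_sw addrAC; congr (_ + _); last first.
  by rewrite -[RHS]scale1r; congr (_ *: _).
have dl : linear (cdga_d A) by exact: linearP.
have e u v : ksign (wdeg u) *: total_tau (sw u) (total_tau (sw v) a) =
   (if nilp u then cdga_d A (t (sw v) a) else 0) +
   (if nilp v then ksign (wdeg u) *: t (sw u) (cdga_d A a) else 0) +
   ksign (wdeg u) *: t (sw u) (t (sw v) a).
  rewrite -[total_tau _ (total_tau _ _)]/(tau0 _ (tau0 _ a + t _ a) + t _ (tau0 _ a + t _ a)).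
  rewrite (lin_funD _ _ (tr _)) !scalerDr -addrA; congr (_ + (_ + _)).
    rewrite tau0_sw; case: u => [|b u] /=; last exact: scaler0.
    rewrite wdeg_nil scale1r (lin_funD _ _ dl) tau0_sw.
    by case: nilp; rewrite ?cdga_d_sq ?(lin_fun0 dl) add0r.
  by rewrite tau0_sw; case: nilp; rewrite // (lin_fun0 (tr _)) scaler0.
rewrite (eq_unsh (fun u v _ _ => e u v)) !unshD; congr (_ + _).
rewrite (unsh_nill w (fun v => cdga_d A (t (sw v) a))).
rewrite (unsh_nilr w (fun u => ksign (wdeg u) *: t (sw u) (cdga_d A a))).
by rewrite -scaleNr; congr (_ + _ *: _); ksolve.
Qed.

Lemma der_bracketl_linear n : linear (der_bracket (-1) n (cdga_d A)).
Proof.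
have dl : linear (cdga_d A) by exact: linearP.
move=> c f g; apply/funext => a.
rewrite -[LHS]/(cdga_d A (c *: f a + g a) - _ *: (c *: f (cdga_d A a) + g (cdga_d A a))).
rewrite -[RHS]/(c *: (cdga_d A (f a) - _ *: f (cdga_d A a)) +
  (cdga_d A (g a) - ksign (-1 * n) *: g (cdga_d A a))).
by rewrite dl !scalerDr !scalerN opprD addrACA !scalerA [c * _]mulrC.
Qed.

Lemma twisting_cochainP : no_curvature total_tau total_h <->
  (forall n x, homog grS n x ->
    hom_diff (total_d par) (der_bracket (-1) (n - 1) (cdga_d A)) (-1) t x
    + twedge iota t x = 0).
Proof.
split=> H.
  move=> n; apply: homog_sym_ext => [|c x y|w <-].
  - apply: lin_add; last by apply: lin_scale; exact: conv_linear twedge_bil.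
    apply: lin_add; first exact: (lin_comp (der_bracketl_linear _) t_der.1).
    apply: lin_scale; apply: (lin_comp t_der.1) => c x y; rewrite !total_dE.
    exact: coder_of_linear total_h_deg _ _ _.
  - by rewrite scaler0 addr0.
  - by apply/funext => a; rewrite twisting_curvature H.
by move=> w a; rewrite -twisting_curvature H //; exact: homog_sw.
Qed.

Lemma total_sqP : (forall w, corest (coder_of total_h (coder_of total_h (sw w))) = 0) <->
  (forall x, total_d par (total_d par x) = 0).
Proof.
have hd := total_h_deg; split=> H.
  move=> x; rewrite !total_dE; move: x.
  exact: (coder_eq0 iota (coder_deg_sq (coder_ofP hd))).
by move=> w; rewrite -!total_dE H (lin_fun0 (@corest_is_linear _ _ _)).
Qed.

Lemma der_act_linear a : linear (@der_act R A a).
Proof.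
move=> c f g; apply/funext => b.
by rewrite -[LHS]/(a * (c *: f b + g b)) mulrDr -scalerAr.
Qed.

Lemma tcomp_multilinearP j :
  is_multilinear (@der_act R A) (-1) (tcomp t j) <-> tau_multilinear (tcomp t j).
Proof.
have ml := multilinearP (-1) der_act_linear (tcomp_der j).1; split=> [/ml H|H].
  move=> m a alpha w b ha; rewrite H // -[LHS]/(_ *: (a * _)).
  by congr (_ *: _); ksolve.
apply/ml => m a alpha v ha; apply/funext => b; rewrite H //.
by rewrite -[RHS]/(_ *: (a * _)); congr (_ *: _); ksolve.
Qed.

(** When the length of [w] is not [j], all terms vanish, so the rule for words of length [j] extends
    to all words. *)
Lemma constituent_leibnizP j :
  tau_leibniz (tcomp t j) (constituent par j) <->
  (forall (w : seq (letter grL)) alpha m a, size w = j -> homog grA m a ->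
    constituent par j (sw (rcons w (lact m a alpha))) =
      act (tcomp t j (sw w) a) (lval alpha)
      + ksign ((wdeg w + 1) * m) *:
          act a (constituent par j (sw (rcons w alpha)))).
Proof.
split=> [/(tau_leibnizP _ (cons_deg j)) H w alpha m a _ ha|H]; first exact: H.
apply/(tau_leibnizP _ (cons_deg j)) => w alpha m a ha.
have [/eqP sw|sw] := boolP (size w == j); first exact: H.
rewrite !constituent_hpart tcomp_sw !size_rcons eqSS (negbTE sw).
by rewrite (lin_fun0 (act_linl _)) (lin_fun0 (act_linr _)) scaler0 addr0.
Qed.

Lemma total_multilinear :
  (forall j, (0 < j)%N -> tau_multilinear (tcomp t j)) -> tau_multilinear t.
Proof.
move=> H m a alpha w b ha.
by have := H (size w).+1 isT m a alpha w b ha; rewrite !tcomp_sw /= eqxx.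
Qed.

(** For nonempty [w] the rule is that of the weight [j = size w]. The empty word is seen by no
    [j > 0]; there both sides are zero. *)
Lemma total_leibniz :
    (forall j, (0 < j)%N -> tau_leibniz (tcomp t j) (constituent par j)) ->
  tau_leibniz t hpart.
Proof.
move=> H m a alpha w ha; have [w0|w0] := posnP (size w); last first.
  have := H _ w0 m a alpha w ha.
  by rewrite !constituent_hpart !tcomp_sw /= !eqxx.
rewrite (size0nil w0) !hpart_le1 //; case: ht => _ _ ->.
by rewrite (lin_fun0 (act_linl _)) (lin_fun0 (act_linr _)) !scaler0 addr0.
Qed.

Lemma tcomp_weight j (u : seq (letter grL)) : size u != j -> tcomp t j (sw u) = 0.
Proof. by rewrite tcomp_sw => /negbTE ->. Qed.

Lemma constituent_weight j (u : seq (letter grL)) :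
  size u != j.+1 -> constituent par j (sw u) = 0.
Proof. by rewrite constituent_hpart => /negbTE ->. Qed.

Lemma sym_Dj_fil j l p phi : linear phi ->
  sym_fil l phi -> sym_fil (l + j) (sym_Dj par t j p phi).
Proof.
move=> phil /(sym_filP _ phil) h; rewrite sym_DjE.
have dl := coder_act_linear (tcomp_der j) (cons_deg j) p phil.
apply/sym_filP => // w wl; rewrite -(coder_act0 (constituent par j) p w (tcomp_der j)).
apply: (coder_act_weight (j := j)) => //.
- exact: tcomp_der.
- by move=> c x y; rewrite /= scaler0 addr0.
- exact: tcomp_weight.
- exact: constituent_weight.
by move=> v s; apply: h; rewrite -(ltn_add2r j) s.
Qed.

Lemma sym_D0_fil l p (phi : S -> A) : linear phi ->
  sym_fil l phi -> sym_fil l (sym_D0 p phi).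
Proof.
move=> phil /(sym_filP _ phil) h; rewrite sym_D0E //.
have dl := coder_act_linear (@tau0_der _ _ L) (@h0_deg _ _ L) p phil.
apply/sym_filP => // w wl; rewrite -(coder_act0 (@h0 _ _ L) p w (@tau0_der _ _ L)).
apply: (coder_act_weight (j := 0%N)) => //.
- exact: tau0_der.
- exact: h0_deg.
- by move=> c x y; rewrite /= scaler0 addr0.
- by move=> u u0; apply/funext => a; rewrite tau0_sw /nilp (negbTE u0).
- by case=> [|b [|b' u]] //= _; rewrite /h0 corest_sw linear0.
by move=> v; rewrite addn0 => s; apply: h; rewrite s.
Qed.

(* [D_j phi] in weight [k + j] only depends on the component of [phi] of weight
   [k], which has filtration [k]. *)
Lemma sym_Dj_sharp j p phi : comp p phi ->
    (forall l p phi, comp p phi -> sym_fil l phi ->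
      sym_fil (l + j.+1) (sym_Dj par t j p phi)) ->
  sym_Dj par t j p phi = 0.
Proof.
move=> hphi H; have [phil _ _] := hphi; rewrite sym_DjE.
apply/funext; apply: linear_sym_ext => [|c x y|w].
- by apply: coder_act_linear => //; exact: tcomp_der.
- by rewrite /= scaler0 addr0.
have l0 : linear (0 : S -> A) by move=> c x y; rewrite /= scaler0 addr0.
have [wj|jw] := ltnP (size w) j.
  rewrite -[RHS](coder_act0 (constituent par j) p w (tcomp_der j)).
  apply: (coder_act_weight (j := j)) => //.
  - exact: tcomp_der.
  - exact: tcomp_weight.
  - exact: constituent_weight.
  by move=> v s; move: wj; rewrite -s ltnNge leq_addl.
pose psi x := phi (wproj (size w - j) x).
have psil : linear psi by apply: (lin_comp phil); exact: wproj_is_linear.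
have psiE v : psi (sw v) = if size v == (size w - j)%N then phi (sw v) else 0.
  by rewrite /psi wproj_sw; case: ifP; rewrite // (lin_fun0 phil).
have hpsi : comp p psi.
  move/sym_form_firstP: hphi => [_ phid phim]; apply/sym_form_firstP; split=> //.
    by move=> n x hx; apply: phid; rewrite -[n]addr0; exact: wproj_homog.
  move=> m a alpha v ha; rewrite !psiE /=; case: ifP => _; first exact: phim.
  by rewrite mulr0 scaler0.
have fpsi : sym_fil (size w - j) psi.
  by apply/sym_filP => // v vl; rewrite psiE (ltn_eqF vl).
(* The index is [size w - j + j.+1 = (size w).+1], just enough for vanishing on [w] itself. *)
have e := H _ _ _ hpsi fpsi (sw w); rewrite addnS subnK // in e.
transitivity (sym_Dj par t j p psi (sw w)); last exact: e (coaug_sw (ltnSn _)).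
rewrite sym_DjE; apply: (coder_act_weight (j := j)) => //.
- exact: tcomp_der.
- exact: tcomp_weight.
- exact: constituent_weight.
by move=> v s; rewrite psiE -s addnK eqxx.
Qed.


Lemma total_differentialE (E : int -> (S -> A) -> S -> A) :
    (forall p phi, comp p phi -> E p phi = coder_act t hpart p phi) ->
  forall p phi, comp p phi ->
    sym_D0 p phi + E p phi = coder_act total_tau total_h p phi.
Proof.
by move=> hE p phi hphi; rewrite hE // total_coder_act //; case: hphi.
Qed.

(** Under either notion of convergence, evaluation on [w] at an index past both the convergence
    bound and [size w] gives the value of the total operator. *)
Lemma sum_unique (E : int -> (S -> A) -> S -> A) :
    (@naive_sum R (sym_data (sym_D par t)) E \/ @fil_sum R (sym_data (sym_D par t)) E) ->
    is_differential comp (fun p x => sym_D0 p x + E p x) ->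
  forall p phi, comp p phi -> E p phi = coder_act t hpart p phi.
Proof.
move=> hE [[hd _] _] p phi hphi; have [phil _ _] := hphi.
(* Linearity of [E p phi] is not part of the notion of sum; it follows since [D_0 phi] and
   [D_0 phi + E phi] are forms. *)
have El : linear (E p phi).
  have [sl _ _] := hd p phi hphi.
  have [dl _ _] := (cdga_der (@sym_cdga _ _ L iota)).1.1 _ _ hphi.
  have -> : E p phi = (fun x => -1 *: sym_D0 p phi x + (sym_D0 p phi + E p phi) x).
    by apply/funext => x; rewrite scaleN1r -[X in _ + X]/(_ + E p phi x) addKr.
  exact: (lin_add (lin_scale _ dl) sl).
apply/funext; apply: linear_sym_ext => // [|w].
  by apply: coder_act_linear => //; [exact: t_der|exact: hpart_deg].
have psE n : partial_sum (X := sym_data (sym_D par t)) p phi n =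
    \sum_(1 <= j < n) sym_Dj par t j p phi.
  by rewrite /partial_sum !big_nat; apply: eq_bigr => -[].
case: hE => [/(_ p phi hphi)[N hN]|[_ /(_ p phi hphi)[_ /(_ (size w).+1)[N hN]]]].
  rewrite -(hN (maxn N (size w).+1)) ?leq_maxl // psE sum_sym_Dj //.
  exact: leq_maxr.
have := hN (maxn N (size w).+1) (leq_maxl _ _) _ (coaug_sw (ltnSn _)).
rewrite psE => /eqP; rewrite subr_eq0 => /eqP ->.
by rewrite sum_sym_Dj //; exact: leq_maxr.
Qed.

(** * The two implications *)

Lemma sh_lie_rinehart_mdca : is_sh_lie_rinehart iota par t ->
  (forall j, (0 < j)%N -> passes_to_sym (sym_Dj par t j)) /\
  is_mdca (sym_data (sym_D par t)).
Proof.
move=> [[_ hlie] [_ haction] hmul hleib].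
have tm j : (0 < j)%N -> tau_multilinear (tcomp t j).
  by move=> j0; apply/tcomp_multilinearP/hmul.
have tl j : (0 < j)%N -> tau_leibniz (tcomp t j) (constituent par j).
  by move=> j0; apply/constituent_leibnizP => w alpha m a; exact: hleib.
have hder j (j0 : (0 < j)%N) : is_gr_der comp (@cup R A L) (-1) (sym_Dj par t j).
  exact: (coder_act_gr_der (tcomp_der j) (cons_deg j) (tm j j0) (tl j j0)).
have tmt := total_multilinear tm; have tlt := total_leibniz tl.
have cl p phi : comp p phi -> linear phi by case.
split; first by move=> j j0; exact: (hder j j0).1.1.
split => /=.
- exact: sym_cdga.
- by move=> p phi /cl phil x; rewrite /coaug big_ord0 => <-; exact: lin_fun0.
- move=> l p phi /cl phil /(sym_filP _ phil) h; apply/sym_filP => // w wl.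
  by apply: h; rewrite ltnS ltnW.
- by [].
- move=> l p c phi psi _ _ hphi hpsi x xl.
  by rewrite -[LHS]/(c *: phi x + psi x) hphi // hpsi // scaler0 addr0.
- by move=> l p phi /cl phil; exact: sym_D0_fil.
- by case=> // j; exact: hder.
- by case=> // j _ l p phi /cl phil; exact: sym_Dj_fil.
- by case=> // j _ [p [phi [hphi nz]]] H; apply: nz; exact: sym_Dj_sharp.
exists (coder_act t hpart); split.
  (* Convergence is in the filtration: the series is finite on each word, but not necessarily on a
     form. *)
  right; split; first exact: sym_complete.
  move=> p phi hphi; have phil := cl _ _ hphi; split.
    exact: (coder_act_gr_linear t_der hpart_deg tmt tlt).1.
  move=> l; exists l => n ln.
  have psE : partial_sum (X := sym_data (sym_D par t)) p phi n =
      \sum_(1 <= j < n) sym_Dj par t j p phi.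
    by rewrite /partial_sum !big_nat; apply: eq_bigr => -[].
  have dl := coder_act_linear t_der hpart_deg p phil.
  have sl : linear (\sum_(1 <= j < n) sym_Dj par t j p phi).
    elim/big_ind: _ => [c x y|f g fl gl|j _].
    - by rewrite /= scaler0 addr0.
    - exact: (lin_add fl gl).
    - exact: (coder_act_linear (tcomp_der j) (cons_deg j)).
  rewrite /= psE; apply/sym_filP => [c x y|w wl].
    by rewrite -[LHS]/(_ - _) dl sl opprD addrACA scalerBr.
  by rewrite -[LHS]/(_ - _) sum_sym_Dj ?subrr // (leq_trans wl).
have e := total_differentialE (fun p phi (_ : comp p phi) => erefl).
have hd : is_differential comp (coder_act total_tau total_h).
  apply: coder_act_differential.
  - exact: total_tau_der.
  - exact: total_h_deg.
  - by apply: tau_multilinearD => //; exact: tau0_multilinear.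
  - by apply: tau_leibnizD => //; exact: tau0_leibniz.
  - exact/twisting_cochainP.
  - by move=> x; rewrite -!total_dE.
split; first split.
- by move=> p phi hphi; rewrite e //; exact: hd.1.1.
- by move=> p c phi psi hphi hpsi; rewrite !e //; [exact: hd.1.2|exact: sym_formP].
- by move=> p phi hphi; rewrite (e p) // e; [exact: hd.2|exact: hd.1.1].
Qed.

(** The differential gives the sh Lie and twisting conditions through the total operator; [hpass]
    gives multilinearity and the Leibniz rule for each [j]. *)
Lemma mdca_sh_lie_rinehart : bidual_injective L ->
    (forall j, (0 < j)%N -> passes_to_sym (sym_Dj par t j)) ->
    is_mdca (sym_data (sym_D par t)) ->
  is_sh_lie_rinehart iota par t.
Proof.
move=> hL hpass hmd; have [E [hE hd]] := mdca_sum hmd.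
have e := total_differentialE (sum_unique hE hd).
have sq p phi w : comp p phi ->
    coder_act total_tau total_h (p - 1) (coder_act total_tau total_h p phi) (sw w) = 0.
  move=> hphi; have hphi1 := hd.1.1 _ _ hphi; have := hd.2 _ _ hphi.
  rewrite /= (e p phi hphi) e; last by rewrite -(e p phi hphi).
  by move=> ->.
have htau := total_tau_der; have hh := total_h_deg.
split.
- split=> //; apply/total_sqP => w.
  exact: (corest_sq_of_sq htau hh w hL sq).
- by split=> //; apply/twisting_cochainP; exact: curvature_eq0_of_sq.
- move=> j j0; apply/tcomp_multilinearP.
  exact: (tau_multilinear_of_sym (tcomp_der j) (cons_deg j) (hpass j j0)).
- move=> j w alpha m a j0; have /constituent_leibnizP := tau_leibniz_of_sym
    (tcomp_der j) (cons_deg j) hL (hpass j j0).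
  exact.
Qed.

End Data.

Theorem theorem5p15 (R : comNzRingType) (iota : {rmorphism rat -> R})
    (A : cdga R) (L : dgModule A) (hL : bidual_injective L)
    (par : Sym (dgm_gr (susp L)) -> Sym (dgm_gr (susp L)))
    (hpar : is_filtered_coder par)
    (t : Sym (dgm_gr (susp L)) -> A -> A) (ht : is_filtered_morphism t) :
  (is_sh_lie_rinehart iota par t <->
     (forall j, (0 < j)%N -> passes_to_sym (sym_Dj par t j)) /\
     is_mdca (sym_data (sym_D par t))) /\
  (forall h : is_sh_lie_rinehart iota par t,
     maurer_cartan_algebra (ShLieRinehart h) = sym_data (sym_D par t)).
Proof.
split=> //; split; first exact: sh_lie_rinehart_mdca.
by case; exact: mdca_sh_lie_rinehart.
Qed.
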